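(* Let $(A,B,\ell,g)$ be admissible data, let $m_0\in\mathcal P(\mathbb R^d)$ have compact support, let $(N_t,N_s)$ be admissible discretization parameters and let $\varepsilon>0$. Then the discrete MFG problem, i.e. find $M\in\mathcal M$ such that $M=\mathbf{br}(M)$, admits at least one solution $M^*\in\mathcal M$.
   Context: **Notation.** $T>0$, $1\le r\le d$ integers, $p\in(1,\infty)$. $|\cdot|$ is the maximum norm on $\mathbb R^n$ and the induced norm on matrices; $\overline{\mathrm B}(x,R)$ is the closed ball for this norm. $\mathcal P(X)$ is the set of Borel probability measures on $X$; $\mathcal P_1(\mathbb R^d)$ those with finite first moment, with the Monge–Kantorovich (Wasserstein-1) metric $d_1$. **Admissible data.** $A:[0,T]\times\mathbb R^d\to\mathbb R^d$, $B:[0,T]\times\mathbb R^d\to\mathbb R^{d\times r}$, $\ell:[0,T]\times\mathbb R^r\times\mathbb R^d\times\mathcal P_1(\mathbb R^d)\to\mathbb R$, $g:\mathbb R^d\times\mathcal P_1(\mathbb R^d)\to\mathbb R$ are continuous and: - there are $\underline\ell,\overline\ell,C_\ell>0$ with $\underline\ell|a|^p-C_\ell\le\ell(t,a,x,\mu)\le\overline\ell|a|^p+C_\ell$ for all $(t,a,x,\mu)$; there is $L_\ell>0$ with $|\ell(t,a,x,\mu)-\ell(t,a,y,\mu)|\le L_\ell(1+|a|^p)|x-y|$ for all $t,a,\mu,x,y$; $\ell$ is convex and continuously differentiable in its second argument $a$; - there are $c_g\in\mathbb R$, $L_g>0$ with $g(x,\mu)\ge c_g$ and $|g(x,\mu)-g(y,\mu)|\le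 L_g|x-y|$ for all $x,y,\mu$; - there are $L_A,L_B,C_B>0$ with $|A(t,x)-A(t,y)|\le L_A|x-y|$, $|B(t,x)-B(t,y)|\le L_B|x-y|$, $|B(t,x)|\le C_B$ for all $t,x,y$; and there are fixed indices $\{i_1,\dots,i_r\}\subset\{1,\dots,d\}$ such that for all $(t,x)$ the rows $i_1,\dots,i_r$ of $B(t,x)$ are linearly independent. Set $C_A=\max\{\max_{t}|A(t,0)|,L_A\}$. **Constant $\widehat C$.** For $N_t\in\mathbb N$ put $\mathcal I=\{0,\dots,N_t\}$, $\mathcal I^*=\mathcal I\setminus\{N_t\}$, $\Delta t=T/N_t$, $t_k=k\Delta t$. For $m\in C([0,T];\mathcal P_1(\mathbb R^d))$, $k\in\mathcal I^*$, $x\in\mathbb R^d$ and $\alpha=(\alpha_k,\dots,\alpha_{N_t-1})\in(\mathbb R^r)^{N_t-k}$ let $J_{k,x}(\alpha)=\Delta t\sum_{j=k}^{N_t-1}\ell(t_j,\alpha_j,\gamma_j,m(t_j))+g(\gamma_{N_t},m(T))$, with $\gamma_k=x$, $\gamma_{j+1}=\gamma_j+\Delta t(A(t_j,\gamma_j)+B(t_j,\gamma_j)\alpha_j)$. $\widehat C>0$ is a fixed constant such that for all $N_t,m,k,x$ every minimizer $\widehat\alpha$ of $J_{k,x}$ satisfies $\max_j|\widehat\alpha_j|\le\widehat C$ (such a constant exists). **Grid and interpolation.** Coordinates are ordered so that $\{i_1,\dots,i_r\}=\{1,\dots,r\}$. Write $x=(\mathrm x_1,\mathrm x_2)\in\mathbb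 R^r\times\mathbb R^{d-r}$, $A=(A_1,A_2)$, and $B=\binom{B_1}{B_2}$ with $B_1(t,x)\in\mathbb R^{r\times r}$ invertible. For $N_s\in\mathbb N$ let $\Delta x=1/N_s$, $\mathcal G_r=\Delta x\,\mathbb Z^r$, $\mathcal G_{d-r}=\Delta x\,\mathbb Z^{d-r}$, $\mathcal G=\mathcal G_r\times\mathcal G_{d-r}$. $(\beta_{\mathrm x_2})_{\mathrm x_2\in\mathcal G_{d-r}}$ is a $\mathbb Q_1$ finite element basis on a regular mesh of $\mathbb R^{d-r}$ with vertices in $\mathcal G_{d-r}$: each $\beta_{\mathrm x_2}$ is nonnegative, a polynomial of partial degree $\le1$ on each mesh element, $\beta_{\mathrm x_2}(\mathrm x_2)=1$, $\beta_{\mathrm x_2}(\mathrm x_2')=0$ for other vertices $\mathrm x_2'$, $\sum_{\mathrm x_2}\beta_{\mathrm x_2}\equiv1$, and $\operatorname{supp}\beta_{\mathrm x_2}\subset\{\mathrm y_2:|\mathrm y_2-\mathrm x_2|\le C_I\Delta x\}$ with $C_I>0$ independent of $\Delta x$. For $F\subset\mathcal G_{d-r}$ and $\varphi:F\to\mathbb R$, $I_F[\varphi](\mathrm y_2)=\sum_{\mathrm x_2\in F}\beta_{\mathrm x_2}(\mathrm y_2)\varphi(\mathrm x_2)$. **State sets.** Let $K_0=\operatorname{supp}(m_0)$ and $K_{k+1}=K_k+\big(\Delta t[C_A(1+\sup_{x\in K_k}|x|)+C_B\widehat C]+C_I\Delta x\big)\overline{\mathrm B}(0,1)$ for $k\in\mathcal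 I^*$. There is a compact $K\subset\mathbb R^d$, fixed once and for all, containing all $K_k$ for all $(\Delta t,\Delta x)$ with $\Delta x\le\Delta t$; $c_K>0$ is a constant with $|B_1(t,x)^{-1}|\le c_K$ on $[0,T]\times K$. For $k\in\mathcal I^*$, $x\in\mathcal G$, $\mathrm y_1\in\mathbb R^r$: $$\alpha(k,x,\mathrm y_1)=B_1(t_k,x)^{-1}\Big[\tfrac{\mathrm y_1-\mathrm x_1}{\Delta t}-A_1(t_k,x)\Big],\quad \mathbf{y_2}(k,x,\mathrm y_1)=\mathrm x_2+\Delta t[A_2(t_k,x)+B_2(t_k,x)\alpha(k,x,\mathrm y_1)],$$ $\mathcal S^1_{k+1}(x)=\{\mathrm y_1\in\mathcal G_r:|\alpha(k,x,\mathrm y_1)|\le\widehat C\}$, $\mathcal S^2_{k+1}(x,\mathrm y_1)=\{\mathrm y_2\in\mathcal G_{d-r}:\mathbf{y_2}(k,x,\mathrm y_1)\in\operatorname{supp}\beta_{\mathrm y_2}\}$, $\mathcal S_{k+1}(x)=\{(\mathrm y_1,\mathrm y_2):\mathrm y_1\in\mathcal S^1_{k+1}(x),\mathrm y_2\in\mathcal S^2_{k+1}(x,\mathrm y_1)\}$, $\mathcal S_0=\mathcal G\cap K_0$, $\mathcal S_{k+1}=\bigcup_{x\in\mathcal S_k}\mathcal S_{k+1}(x)$. **Admissible discretization parameters.** $(N_t,N_s)$ such that $\Delta x/\Delta t\le\min\{1,\widehat C/c_K\}$ and, with $E(x)=\{y\in\mathbb R^d:|x-y|\le\Delta x/2\}$,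 $m_0(\partial E(x))=0$ for all $x\in\mathcal G$. **Discrete MFG problem.** Let $\varepsilon>0$, $\mathcal M=\prod_{k\in\mathcal I}\mathcal P(\mathcal S_k)$ (elements of $\mathcal P(\mathcal S_k)$ are identified with finitely supported measures on $\mathbb R^d$), $\mathcal E_F(q)=\sum_{x\in F}q(x)\log q(x)$ ($0\log0=0$). For $M=(M_k)_{k}\in\mathcal M$ let $V^M_{N_t}(x)=g(x,M_{N_t})$ on $\mathcal S_{N_t}$ and, for $k\in\mathcal I^*$, $x\in\mathcal S_k$, $$V^M_k(x)=\min_{q\in\mathcal P(\mathcal S^1_{k+1}(x))}\Big\{\sum_{\mathrm y_1\in\mathcal S^1_{k+1}(x)}q(\mathrm y_1)\big[\Delta t\,\ell(t_k,\alpha(k,x,\mathrm y_1),x,M_k)+I_{\mathcal S^2_{k+1}(x,\mathrm y_1)}[V^M_{k+1}(\mathrm y_1,\cdot)](\mathbf{y_2}(k,x,\mathrm y_1))\big]+\varepsilon\mathcal E_{\mathcal S^1_{k+1}(x)}(q)\Big\}.$$ Let $p^M_k(x,\cdot)$ be the unique minimizer; $P^M_k(x,y)=p^M_k(x,\mathrm y_1)\beta_{\mathrm y_2}(\mathbf{y_2}(k,x,\mathrm y_1))$ if $y=(\mathrm y_1,\mathrm y_2)\in\mathcal S_{k+1}(x)$, and $0$ if $y\in\mathcal S_{k+1}\setminus\mathcal S_{k+1}(x)$. The best response mapping $\mathbf{br}:\mathcal M\to\mathcal M$ is $\mathbf{br}(M)=\widehat M$ with $\widehat M_0(x)=m_0(E(x))$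 for $x\in\mathcal S_0$, and $\widehat M_{k+1}(y)=\sum_{x\in\mathcal S_k}P^M_k(x,y)\widehat M_k(x)$ for $k\in\mathcal I^*$, $y\in\mathcal S_{k+1}$.
   Formalization: Added assumption: the masses m_0(E(x)), x in S_0, sum to 1. Without it the claim can fail (for m_0 a Dirac mass off the grid and interior to a cell, S_0 and M are empty), and any solution forces it. *)

(* Defs.v *)
From HB Require Import structures.
From mathcomp Require Import all_boot all_order all_algebra.
From mathcomp Require Import all_classical all_reals all_analysis.

Set Implicit Arguments.
Unset Strict Implicit.
Unset Printing Implicit Defensive.

Import Order.TTheory GRing.Theory Num.Theory.
Import numFieldNormedType.Exports.

Local Open Scope classical_set_scope.
Local Open Scope ring_scope.

(* Vectors are column vectors; the library norm on ['cV[R]_n] is the maximum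
   norm.  On matrices the library norm is the largest entry, which is not the
   operator norm induced by the maximum norm, hence the definition below. *)
Definition opnorm (R : realType) (m n : nat) (M : 'M[R]_(m, n)) : R :=
  sup [set `|M *m v| | v in [set v : 'cV[R]_n | `|v| <= 1]].

(* R^n with its Borel sigma-algebra. *)
Definition Rn (R : realType) (n : nat) := g_sigma_algebraType (@open 'cV[R]_n).

Section measures.
Context (R : realType) (n : nat).
Local Open Scope ereal_scope.

Record P1 := MkP1 {
  P1_val :> probability (Rn R n) R ;
  P1_moment : \int[P1_val]_x (`|(x : 'cV[R]_n)|%R)%:E < +oo }.

Definition coupling (mu nu : P1) (pi : probability (Rn R n * Rn R n)%type R) :=
  (forall U : set (Rn R n), measurable U -> pi (U `*` setT) = mu U) /\
  (forall U : set (Rn R n), measurable U -> pi (setT `*` U) = nu U).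

Definition d1 (mu nu : P1) : \bar R :=
  ereal_inf [set \int[pi]_z (`|(z.1 : 'cV[R]_n) - (z.2 : 'cV[R]_n)|%R)%:E
            | pi in coupling mu nu].

Definition msupp (mu : probability (Rn R n) R) : set 'cV[R]_n :=
  [set x | forall U : set 'cV[R]_n, open U -> U x -> 0 < mu U].

Definition mass (mu : probability (Rn R n) R) (x : 'cV[R]_n) : R :=
  fine (mu [set x]).

End measures.

Definition fsupp (R : realType) (n : nat) (f : 'cV[R]_n -> R) : set 'cV[R]_n :=
  closure [set y | f y != 0].

Definition frontier (T : topologicalType) (E : set T) : set T :=
  closure E `\` interior E.

(* Probability mass functions on F, extended by 0 outside F.  The sum is the
   finitely supported one; F is always finite where this is used. *)
Definition pmf (R : realType) (T : choiceType) (F : set T) : set (T -> R) :=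
  [set q | [/\ forall y, 0 <= q y, forall y, ~ F y -> q y = 0 &
               \sum_(y \in F) q y = 1]].

(* [ln 0 = 0], so that the convention 0 log 0 = 0 holds. *)
Definition entropy (R : realType) (T : choiceType) (F : set T) (q : T -> R) : R :=
  \sum_(y \in F) q y * ln (q y).

Record mfg_data (R : realType) (d r : nat) := MFGData {
  drift : R -> 'cV[R]_d -> 'cV[R]_d ;
  ctrl : R -> 'cV[R]_d -> 'M[R]_(d, r) ;
  ell : R -> 'cV[R]_r -> 'cV[R]_d -> P1 R d -> R ;
  gfin : 'cV[R]_d -> P1 R d -> R }.

Section data.
Context (R : realType) (d r : nat) (T p : R) (D : mfg_data R d r).

Let I : set R := [set t | 0 <= t <= T].
Let cyl : set (R * 'cV[R]_d) := [set z | I z.1].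

Definition ell_continuous : Prop :=
  forall t a x mu, I t -> forall e : R, 0 < e -> exists2 delta : R, 0 < delta &
    forall t' a' x' mu', I t' ->
      `|t - t'| < delta -> `|a - a'| < delta -> `|x - x'| < delta ->
      (d1 mu mu' < delta%:E)%E ->
      `|ell D t a x mu - ell D t' a' x' mu'| < e.

Definition gfin_continuous : Prop :=
  forall x mu (e : R), 0 < e -> exists2 delta : R, 0 < delta &
    forall x' mu', `|x - x'| < delta -> (d1 mu mu' < delta%:E)%E ->
      `|gfin D x mu - gfin D x' mu'| < e.

Definition ell_admissible : Prop :=
  [/\ ell_continuous,
      exists ellm ellM Cell : R, [/\ 0 < ellm, 0 < ellM, 0 < Cell &
        forall t a x mu, I t ->
          ellm * `|a| `^ p - Cell <= ell D t a x mu <= ellM * `|a| `^ p + Cell],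
      exists2 Lell : R, 0 < Lell &
        forall t a x y mu, I t ->
          `|ell D t a x mu - ell D t a y mu| <= Lell * (1 + `|a| `^ p) * `|x - y|,
      forall t x mu, I t ->
        @convex_function R 'cV[R]_r setT (fun a => ell D t a x mu) &
      forall t x mu, I t ->
        (forall a, differentiable (fun b => ell D t b x mu : R) a) /\
        (* continuity of the differential, along each direction *)
        (forall v : 'cV[R]_r,
            continuous (fun a => 'D_v (fun b => ell D t b x mu : R) a))].

Definition gfin_admissible : Prop :=
  [/\ gfin_continuous,
      exists cg : R, forall x mu, cg <= gfin D x mu &
      exists2 Lg : R, 0 < Lg &
        forall x y mu, `|gfin D x mu - gfin D y mu| <= Lg * `|x - y|].

(* [idx] enumerates the fixed indices i_1, ..., i_r. *)
Definition dynamics_admissible (idx : 'I_r -> 'I_d) (LA CB : R) : Prop :=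
  [/\ {within cyl, continuous (fun z => drift D z.1 z.2)},
      {within cyl, continuous (fun z => ctrl D z.1 z.2)},
      0 < LA /\ forall t x y, I t -> `|drift D t x - drift D t y| <= LA * `|x - y|,
      exists2 LB : R, 0 < LB &
        forall t x y, I t -> opnorm (ctrl D t x - ctrl D t y) <= LB * `|x - y| &
      [/\ 0 < CB, forall t x, I t -> opnorm (ctrl D t x) <= CB,
          injective idx &
          forall t x, I t -> row_free (rowsub idx (ctrl D t x))]].

Definition admissible_data (idx : 'I_r -> 'I_d) (LA CB : R) : Prop :=
  [/\ ell_admissible, gfin_admissible & dynamics_admissible idx LA CB].

Definition drift_cst (LA : R) : R :=
  Num.max (sup [set `|drift D t 0| | t in I]) LA.

Definition dt (Nt : nat) : R := T / Nt%:R.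
Definition tgrid (Nt k : nat) : R := k%:R * dt Nt.

Definition P1_curve (m : R -> P1 R d) : Prop :=
  forall t, I t -> forall e : R, 0 < e -> exists2 delta : R, 0 < delta &
    forall t', I t' -> `|t - t'| < delta -> (d1 (m t) (m t') < e%:E)%E.

(* [traj Nt k x alpha i] is gamma_(k + i), and alpha_j is [alpha j]. *)
Fixpoint traj (Nt k : nat) (x : 'cV[R]_d) (alpha : nat -> 'cV[R]_r) (i : nat)
    : 'cV[R]_d :=
  if i is i'.+1 then
    let y := traj Nt k x alpha i' in
    let t := tgrid Nt (k + i') in
    y + dt Nt *: (drift D t y + ctrl D t y *m alpha (k + i')%N)
  else x.

Definition cost (Nt : nat) (m : R -> P1 R d) (k : nat) (x : 'cV[R]_d)
    (alpha : nat -> 'cV[R]_r) : R :=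
  dt Nt * \sum_(k <= j < Nt)
      ell D (tgrid Nt j) (alpha j) (traj Nt k x alpha (j - k)) (m (tgrid Nt j))
  + gfin D (traj Nt k x alpha (Nt - k)) (m T).

Definition control_bound (Chat : R) : Prop :=
  0 < Chat /\
  forall Nt m k x (alpha : nat -> 'cV[R]_r),
    (0 < Nt)%N -> P1_curve m -> (k < Nt)%N ->
    (forall alpha', cost Nt m k x alpha <= cost Nt m k x alpha') ->
    forall j, (k <= j < Nt)%N -> `|alpha j| <= Chat.

End data.

Definition dx (R : realType) (Ns : nat) : R := Ns%:R^-1.

Definition grid (R : realType) (n Ns : nat) : set 'cV[R]_n :=
  [set x | forall i, exists z : int, x i 0 = z%:~R * dx R Ns].

Definition polyQ1_on (R : realType) (s : nat) (F : set 'cV[R]_s)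
    (f : 'cV[R]_s -> R) : Prop :=
  exists c : {set 'I_s} -> R, forall y, F y ->
    f y = \sum_(J : {set 'I_s}) c J * \prod_(i in J) y i 0.

(* The mesh elements are the cubes z + [0, dx]^s, z a grid point;
   [beta x2] is the basis function attached to the vertex x2. *)
Definition Q1_basis (R : realType) (s Ns : nat) (CI : R)
    (beta : 'cV[R]_s -> 'cV[R]_s -> R) : Prop :=
  [/\ forall x2 y, grid Ns x2 -> 0 <= beta x2 y,
      forall x2 z, grid Ns x2 -> grid Ns z ->
        polyQ1_on [set y | forall i, z i 0 <= y i 0 <= z i 0 + dx R Ns] (beta x2),
      forall x2 x2', grid Ns x2 -> grid Ns x2' ->
        beta x2 x2' = (x2' == x2)%:R,
      forall y, \sum_(x2 \in @grid R s Ns) beta x2 y = 1 &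
      forall x2, grid Ns x2 ->
        fsupp (beta x2) `<=` [set y | `|y - x2| <= CI * dx R Ns]].

Fixpoint Kset (R : realType) (d : nat) (m0 : probability (Rn R d) R)
    (CA CB Chat CI dt dx : R) (k : nat) : set 'cV[R]_d :=
  if k is k'.+1 then
    let Kk := Kset m0 CA CB Chat CI dt dx k' in
    let rho := dt * (CA * (1 + sup [set `|x| | x in Kk]) + CB * Chat) + CI * dx in
    [set x + rho *: b | x in Kk & b in [set b : 'cV[R]_d | `|b| <= 1]]
  else msupp m0.

Section scheme.
(* The state dimension is d = r + s; [usubmx] and [dsubmx] are the components
   in R^r and R^s. *)
Context (R : realType) (r s : nat) (T : R) (D : mfg_data R (r + s) r).
Context (Chat : R) (beta : 'cV[R]_s -> 'cV[R]_s -> R).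
Context (m0 : probability (Rn R (r + s)) R) (eps : R) (Nt Ns : nat).

Local Notation E1 := 'cV[R]_r.
Local Notation E2 := 'cV[R]_s.
Local Notation E := 'cV[R]_(r + s).
Local Notation Dt := (dt T Nt).
Local Notation t_ k := (tgrid T Nt k).

Definition B1 (t : R) (x : E) : 'M[R]_r := usubmx (ctrl D t x).
Definition B2 (t : R) (x : E) : 'M[R]_(s, r) := dsubmx (ctrl D t x).

Definition gridG : set E := [set x | grid Ns (usubmx x) /\ grid Ns (dsubmx x)].

Definition cell (x : E) : set E := [set y | `|x - y| <= dx R Ns / 2].

Definition ctrl_to (k : nat) (x : E) (y1 : E1) : E1 :=
  invmx (B1 (t_ k) x) *m
    (Dt^-1 *: (y1 - usubmx x) - usubmx (drift D (t_ k) x)).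

Definition y2_end (k : nat) (x : E) (y1 : E1) : E2 :=
  dsubmx x + Dt *: (dsubmx (drift D (t_ k) x) + B2 (t_ k) x *m ctrl_to k x y1).

(* For k < Nt, the sets S^1_(k+1)(x), S^2_(k+1)(x, y1) and S_(k+1)(x). *)
Definition S1 (k : nat) (x : E) : set E1 :=
  [set y1 | grid Ns y1 /\ `|ctrl_to k x y1| <= Chat].

Definition S2 (k : nat) (x : E) (y1 : E1) : set E2 :=
  [set z2 | grid Ns z2 /\ fsupp (beta z2) (y2_end k x y1)].

Definition Sx (k : nat) (x : E) : set E :=
  [set y | S1 k x (usubmx y) /\ S2 k x (usubmx y) (dsubmx y)].

Definition S0 : set E := gridG `&` msupp m0.

Fixpoint Sk (k : nat) : set E :=
  if k is k'.+1 then \bigcup_(x in Sk k') Sx k' x else S0.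

Definition interp (F : set E2) (phi : E2 -> R) (z : E2) : R :=
  \sum_(x2 \in F) beta x2 z * phi x2.

(* The function minimized in the dynamic programming equation at step k, with
   mu the distribution at time k and W the value function at step k + 1. *)
Definition objective (mu : P1 R (r + s)) (W : E -> R) (k : nat) (x : E)
    (q : E1 -> R) : R :=
  \sum_(y1 \in S1 k x) q y1 *
     (Dt * ell D (t_ k) (ctrl_to k x y1) x mu +
      interp (S2 k x y1) (fun z2 => W (col_mx y1 z2)) (y2_end k x y1))
  + eps * entropy (S1 k x) q.

(* [Vback M i] is the value function at step Nt - i. *)
Fixpoint Vback (M : nat -> P1 R (r + s)) (i : nat) (x : E) : R :=
  if i is i'.+1 then
    let k := (Nt - i'.+1)%N in
    inf [set objective (M k) (Vback M i') k x q | q in pmf (S1 k x)]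
  else gfin D x (M Nt).

Definition value (M : nat -> P1 R (r + s)) (k : nat) : E -> R := Vback M (Nt - k).

(* The minimizer, chosen by [xget]; the default value 0 is used only when
   there is none. *)
Definition popt (M : nat -> P1 R (r + s)) (k : nat) (x : E) : E1 -> R :=
  xget (fun=> 0) [set q | pmf (S1 k x) q /\
    forall q', pmf (S1 k x) q' ->
      objective (M k) (value M k.+1) k x q <= objective (M k) (value M k.+1) k x q'].

Definition Ptrans (M : nat -> P1 R (r + s)) (k : nat) (x y : E) : R :=
  if `[< Sx k x y >] then
    popt M k x (usubmx y) * beta (dsubmx y) (y2_end k x (usubmx y))
  else 0.

(* [br M k y] is the mass at the point y of the k-th component of br(M). *)
Fixpoint br (M : nat -> P1 R (r + s)) (k : nat) (y : E) : R :=
  if k is k'.+1 then \sum_(x \in Sk k') Ptrans M k' x y * br M k' x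
  else fine (m0 (cell y)).

(* Elements of P(S_k) as measures on R^d carried by S_k; only the values
   M 0, ..., M Nt matter. *)
Definition mfg_space (M : nat -> P1 R (r + s)) : Prop :=
  forall k, (k <= Nt)%N -> M k (Sk k) = 1%E.

(* M = br(M): a measure carried by the finite set S_k is given by its masses. *)
Definition mfg_solution (M : nat -> P1 R (r + s)) : Prop :=
  mfg_space M /\
  forall k, (k <= Nt)%N -> forall y, Sk k y -> mass (M k) y = br M k y.

Definition admissible_params (cK : R) : Prop :=
  [/\ (0 < Nt)%N, (0 < Ns)%N,
      dx R Ns / Dt <= Num.min 1 (Chat / cK) &
      forall x, gridG x -> m0 (frontier (cell x)) = 0%E].

(* The initial component of br(M) has total mass 1.  This is not automatic: S_0
   consists of the grid points lying in the support of m0, and the cells around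
   them need not cover that support (S_0 may even be empty).  It is necessary
   for a solution to exist, and for br to take values in [mfg_space]. *)
Definition initial_mass_one : Prop :=
  \sum_(x \in S0) fine (m0 (cell x)) = 1.

End scheme.

(* Main.v *)
(** The scheme is a fixed point problem on a product of finite simplices.  With
    the entropic penalty, the minimizer in the dynamic programming equation is
    the Gibbs weight [exp(- c / eps) / Z] and the minimum is [- eps ln Z], so the
    best response depends continuously on the masses once the running and final
    costs do; these are [d1]-continuous, and [d1] between two measures carried by
    the same finite set is controlled by the l1 distance of their masses.
    The assumption on [dx / dt] makes every set of reachable controls nonempty,
    because the states never leave [K].

    Brouwer's theorem on the simplex is obtained from Scarf's combinatorial
    lemma: for finitely many linear orders, indexed by [I], on a finite set whose
    elements are coloured by [I], some "dominant" set carries all the colours.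
    Applied to the points of a fine grid, ordered by their coordinates, a dominant
    set has small diameter, and no triangulation is needed. *)

From mathcomp Require Import all_boot zify.

Set Implicit Arguments.
Unset Strict Implicit.
Unset Printing Implicit Defensive.

(** * Scarf's lemma and Sperner colourings of grids *)

Section Scarf.
Context (X I : finType) (rk : I -> X -> nat).
Hypothesis rk_inj : forall i, injective (rk i).

(** For nonempty [P] this is Scarf's condition: no element lies strictly above the minima of [P] in
    all the orders at once. *)
Definition dominant (P : {set X}) : bool :=
  [forall y, exists i, forall x in P, rk i y <= rk i x].

Lemma dominantP (P : {set X}) :
  reflect (forall y, exists i, forall x, x \in P -> rk i y <= rk i x) (dominant P).
Proof.
apply: (iffP forallP) => h y.
  by have /existsP[i /forall_inP hi] := h y; exists i.
by have [i hi] := h y; apply/existsP; exists i; apply/forall_inP.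
Qed.

Lemma rk_max (i : I) (p : pred X) : (exists x, p x) ->
  exists2 x, p x & forall z, p z -> rk i z <= rk i x.
Proof.
move=> [x0 px0]; case: (@arg_maxnP _ x0 p (rk i) px0) => x px hx.
by exists x.
Qed.

(* A door [Q] has one element fewer than there are orders, so exactly two orders
   [a] and [b] share their minimum on [Q].  A room obtained by adding [x] to [Q]
   replaces the minimum of one of these two, say [a]; then [x] must be the
   [a]-greatest element above [Q] in all the other orders. *)
Section Door.
Context (Q : {set X}).
Hypothesis (Q0 : Q != set0) (domQ : dominant Q) (cardQ : #|I| = #|Q|.+1).

Lemma door_rooms (m : I -> X) :
  (forall i, m i \in Q) -> (forall i x, x \in Q -> rk i (m i) <= rk i x) ->
  exists a b, [/\ a != b, m a = m b &
   #|[set x | (x \notin Q) && dominant (x |: Q)]| =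
     [exists y, [forall i, (i != a) ==> (rk i (m i) < rk i y)]] +
     [exists y, [forall i, (i != b) ==> (rk i (m i) < rk i y)]]].
Proof.
move=> mQ mmin.
have msurj x : x \in Q -> exists i, m i = x.
  move=> xQ; have /dominantP/(_ x)[i hi] := domQ; exists i.
  by apply: (@rk_inj i); apply/eqP; rewrite eqn_leq mmin // hi.
have imm : m @: setT = Q.
  apply/setP => x; apply/imsetP/idP => [[i _ ->]//|/msurj[i <-]]; by exists i.
have : ~~ injectiveb m.
  apply/negP => /injectiveP minj.
  by have := card_imset setT minj; rewrite imm cardsT cardQ => /eqP; rewrite eqn_leq ltnn andbF.
move=> /injectivePn[a [b ab mab]]; exists a, b; split=> //.
(* [Y j] collects the elements that would displace the minimum of [Q] in the order [j] and in no
   other. *)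
pose Y j := [set y | [forall i, (i != j) ==> (rk i (m i) < rk i y)]].
have YP j y : reflect (forall i, i != j -> rk i (m i) < rk i y) (y \in Y j).
  rewrite inE; apply: (iffP forallP) => h i; last by apply/implyP/h.
  exact/implyP.
have surj' j : j \in [set a; b] -> forall x, x \in Q -> exists2 i, i != j & m i = x.
  move=> jab x /msurj[i ix]; case: (eqVneq i j) => [ij|]; last by exists i.
  move: jab; rewrite !inE => /orP[] /eqP jj.
    by exists b; [rewrite jj eq_sym|rewrite -mab -jj -ij].
  by exists a; [rewrite jj|rewrite mab -jj -ij].
have YnQ j y : j \in [set a; b] -> y \in Y j -> y \notin Q.
  move=> jab /YP hy; apply/negP => /(surj' j jab)[i ij iy].
  by have := hy i ij; rewrite iy ltnn.
have Ylt j y : j \in [set a; b] -> y \in Y j -> rk j y < rk j (m j).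
  move=> jab yY; have /dominantP/(_ y)[i hi] := domQ.
  case: (eqVneq i j) => [ij|ij].
    rewrite ltn_neqAle -ij hi ?andbT //; apply/negP => /eqP/rk_inj e.
    by have := YnQ _ _ jab yY; rewrite e mQ.
  by have /YP/(_ i ij) := yY; rewrite ltnNge hi.
(* Elements outside [Y j] are already below the minimum of [Q] in some order other than [j], and
   adding [x] does not lower that minimum; so only the elements of [Y j] have to be tested, in the
   order [j]. *)
have Ydom j x : j \in [set a; b] -> x \in Y j ->
    dominant (x |: Q) = [forall y in Y j, rk j y <= rk j x].
  move=> jab xY; apply/idP/idP.
    move=> /dominantP dx; apply/forall_inP => y yY.
    have [i hi] := dx y; case: (eqVneq i j) => [<-|ij].
      by apply: hi; rewrite !inE eqxx.
    have /YP/(_ i ij) := yY; rewrite ltnNge hi //.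
    by rewrite !inE mQ orbT.
  move=> /forall_inP hx; apply/dominantP => y.
  case: (boolP (y \in Y j)) => [yY|].
    exists j => z; rewrite !inE => /orP[/eqP->|zQ]; first exact: hx.
    by rewrite (leq_trans (ltnW (Ylt _ _ jab yY))) ?mmin.
  rewrite inE negb_forall => /existsP[i]; rewrite negb_imply -leqNgt => /andP[ij hi].
  exists i => z; rewrite !inE => /orP[/eqP->|zQ].
    by rewrite (leq_trans hi) // ltnW //; have /YP := xY; apply.
  by rewrite (leq_trans hi) // mmin.
(* Dominance makes every element of the room a minimum, and the cardinalities agree, so the minima
   [n] form a bijection. Hence [x] is the minimum in a single order [j] and the others keep theirs;
   were [j] neither [a] nor [b], [n a = m a = m b = n b] would break injectivity. *)
have domY x : x \notin Q -> dominant (x |: Q) -> exists2 j, j \in [set a; b] & x \in Y j.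
  move=> xQ /dominantP dx.
  have [n nP] : exists n : I -> X, forall i,
      n i \in x |: Q /\ forall z, z \in x |: Q -> rk i (n i) <= rk i z.
    exists (fun i => [arg min_(y < x in x |: Q) rk i y]) => i.
    by case: arg_minnP => [|y yP hy]; first exact: setU11.
  have nm i : n i != x -> n i = m i.
    move=> nx; have [nQ nmin] := nP i.
    apply: (@rk_inj i); apply/eqP; rewrite eqn_leq nmin ?inE ?mQ ?orbT // mmin //.
    by move: nQ; rewrite !inE (negPf nx).
  have imn : n @: setT = x |: Q.
    apply/setP => z; apply/imsetP/idP => [[i _ ->]|zP]; first exact: (nP i).1.
    have [i hi] := dx z; exists i => //.
    by apply: (@rk_inj i); apply/eqP; rewrite eqn_leq (nP i).2 // hi // (nP i).1.
  have ninj : injective n.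
    have /imset_injP h : #|n @: [set: I]| == #|[set: I]| by rewrite imn cardsU1 xQ cardsT cardQ.
    by move=> i1 i2; apply: h; rewrite inE.
  have [j hj] := dx x.
  have nj : n j = x.
    by apply: (@rk_inj j); apply/eqP; rewrite eqn_leq (nP j).2 ?hj ?(nP j).1 // !inE eqxx.
  exists j.
    rewrite !inE; apply/negPn/negP; rewrite negb_or => /andP[ja jb].
    have nja : n a != x by rewrite -nj (inj_eq ninj) eq_sym.
    have njb : n b != x by rewrite -nj (inj_eq ninj) eq_sym.
    have := nm _ nja; rewrite mab -(nm _ njb) => /ninj e.
    by rewrite e eqxx in ab.
  apply/YP => i ij.
  have nix : n i != x by rewrite -nj (inj_eq ninj).
  rewrite -(nm _ nix) ltn_neqAle (nP i).2 ?inE ?eqxx // andbT.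
  by rewrite (inj_eq (@rk_inj i)).
pose Z j := [set x in Y j | [forall y in Y j, rk j y <= rk j x]].
have ZE j x : (x \in Z j) = (x \in Y j) && [forall y in Y j, rk j y <= rk j x].
  by rewrite in_set.
have cardZ j : #|Z j| = [exists y, y \in Y j].
  case: existsP => [/(rk_max j)[x xY hx]|h].
    apply/eqP/cards1P; exists x; apply/setP => z; rewrite !inE.
    apply/andP/eqP => [[zY /forall_inP hz]|->].
      apply: (@rk_inj j); apply/eqP; rewrite eqn_leq hx ?hz // ?inE //.
    by move: (xY); rewrite inE => ->; split=> //; apply/forall_inP.
  apply/eqP; rewrite cards_eq0 -subset0; apply/subsetP => z; rewrite inE => /andP[zY _].
  by case: h; exists z.
have aab : a \in [set a; b] by rewrite !inE eqxx.
have bab : b \in [set a; b] by rewrite !inE eqxx orbT.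
have -> : [set x | (x \notin Q) && dominant (x |: Q)] = Z a :|: Z b.
  apply/setP => x; rewrite in_set in_setU; apply/andP/orP.
    move=> [xQ dx]; have [j jab xY] := domY x xQ dx.
    by case/set2P: (jab) => jE; [left|right]; rewrite -jE ZE xY -Ydom.
  by move=> []; rewrite ZE => /andP[xY hx]; (split; first exact: YnQ xY); rewrite (Ydom _ _ _ xY).
(* An element of both [Z a] and [Z b] would exceed the minimum of [Q] in every order, against
   dominance. *)
rewrite cardsU (_ : Z a :&: Z b = set0) ?cards0 ?subn0 ?cardZ; last first.
  apply/eqP; rewrite -subset0; apply/subsetP => x; rewrite in_setI !ZE.
  move=> /andP[/andP[/YP xa _] /andP[/YP xb _]].
  have /dominantP/(_ x)[i hi] := domQ.
  have := hi _ (mQ i); rewrite leqNgt; case: (eqVneq i a) => [ia|/xa -> //].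
  by rewrite xb // ia.
by congr (nat_of_bool _ + nat_of_bool _); apply: eq_existsb => y; rewrite inE.
Qed.
End Door.

(* [e i] is a slack element: lowest in the order [i], above all of the genuine
   elements in the other orders. *)
Section Sperner.
Context (e : I -> X) (c : X -> I).
Hypothesis ce : cancel e c.
Hypothesis e_min : forall i x, x != e i -> rk i (e i) < rk i x.
Hypothesis e_max : forall i j x, x \notin codom e -> j != i -> rk i x < rk i (e j).
Hypothesis T0 : exists x, x \notin codom e.

Definition room (P : {set X}) := (#|P| == #|I|) && dominant P.

Lemma dominantS (P Q : {set X}) : Q \subset P -> dominant P -> dominant Q.
Proof.
move=> QP /dominantP dP; apply/dominantP => y; have [i hi] := dP y.
by exists i => x xQ; apply: hi; apply: (subsetP QP).
Qed.

(** A room has as many elements as there are colours. If it carries them all, only its element of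
    colour [i0] can be removed. Otherwise a removable element shares its colour with exactly one
    other, and these two are the removable ones. *)
Lemma odd_typed_doors (i0 : I) (P : {set X}) : room P ->
  odd #|[set x in P | c @: (P :\ x) == [set~ i0]]| = (c @: P == setT).
Proof.
move=> /andP[/eqP cP _].
have cI : c @: P == setT -> {in P &, injective c}.
  by move=> /eqP cPT; apply/imset_injP; rewrite cPT cardsT cP.
case: (boolP (c @: P == setT)) => cPT; last first.
  case: (set_0Vmem [set x in P | c @: (P :\ x) == [set~ i0]]) => [->|[x0]].
    by rewrite cards0.
  rewrite inE => /andP[x0P /eqP cx0].
  have x0i : c x0 != i0.
    apply/negP => /eqP xi; case/negP: cPT; apply/eqP.
    by rewrite -(setD1K x0P) imsetU1 cx0 xi; apply/setP => i; rewrite !inE orbN.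
  have : c x0 \in c @: (P :\ x0) by rewrite cx0 !inE.
  move=> /imsetP[x1]; rewrite !inE => /andP[x10 x1P] cx01.
  have inj0 : {in P :\ x0 &, injective c}.
    apply/imset_injP; rewrite cx0 cardsCs setCK cards1 -cP.
    by rewrite (cardsD1 x0 P) x0P add1n subn1.
  suff -> : [set x in P | c @: (P :\ x) == [set~ i0]] = [set x0; x1].
    by rewrite cards2 eq_sym x10.
  apply/setP => x; rewrite !inE; apply/andP/orP.
    move=> [xP /eqP cx]; case: (eqVneq x x0) => [->|xx0]; [by left|right].
    apply/negPn/negP => xx1.
    have : c x \in c @: (P :\ x).
      rewrite cx !inE; apply/negP => /eqP cxi.
      have : c x \in c @: (P :\ x0) by apply: imset_f; rewrite !inE xx0 xP.
      by rewrite cx0 !inE cxi eqxx.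
    move=> /imsetP[y]; rewrite !inE => /andP[yx yP] cxy.
    case: (eqVneq y x0) => [y0|y0].
      have : x = x1 by apply: inj0; rewrite ?inE ?xx0 ?xP ?x10 ?x1P // cxy y0 cx01.
      by move=> e1; rewrite e1 eqxx in xx1.
    have : x = y by apply: inj0; rewrite ?inE ?xx0 ?xP ?y0 ?yP.
    by move=> e1; rewrite e1 eqxx in yx.
  move=> [] /eqP ->; first by rewrite x0P cx0 eqxx.
  split=> //; rewrite -cx0; apply/eqP/setP => i; apply/imsetP/imsetP.
    move=> [y]; rewrite !inE => /andP[yx yP] ->; case: (eqVneq y x0) => [->|y0].
      by exists x1; rewrite // !inE x10.
    by exists y; rewrite // !inE y0.
  move=> [y]; rewrite !inE => /andP[yx yP] ->; case: (eqVneq y x1) => [->|y1].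
    by exists x0; rewrite // !inE eq_sym x10.
  by exists y; rewrite // !inE y1.
have : i0 \in c @: P by rewrite (eqP cPT) inE.
move=> /imsetP[x0 x0P cx0].
rewrite (_ : [set _ in _ | _] = [set x0]) ?cards1 //.
apply/setP => x; rewrite !inE; apply/andP/eqP.
  move=> [xP /eqP cx]; apply: (cI cPT) => //; rewrite -cx0.
  apply/eqP; apply/negPn/negP => cxi.
  have : i0 \in c @: (P :\ x).
    rewrite cx0; apply: imset_f; rewrite !inE x0P andbT.
    by apply: contra cxi => /eqP <-; rewrite cx0.
  by rewrite cx !inE eqxx.
move=> ->; split=> //; apply/eqP/setP => i; rewrite !inE; apply/imsetP/idP.
  move=> [y]; rewrite !inE => /andP[yx yP] ->; apply: contra yx => /eqP cy.
  by apply/eqP/(cI cPT) => //; rewrite cy.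
move=> ii0; have : i \in c @: P by rewrite (eqP cPT) inE.
move=> /imsetP[y yP iy]; exists y => //; rewrite !inE yP andbT.
by apply: contra ii0 => /eqP yx; rewrite iy yx -cx0.
Qed.

(* Double counting of the pairs (room, door of colours [I \ {i0}]): the only such
   door lying in an odd number of rooms is the one made of slack elements. *)
Lemma colourful_room : 1 < #|I| -> exists2 P, room P & c @: P = setT.
Proof.
move=> I1; have /card_gt0P[i0 _] : 0 < #|I| by rewrite ltnW.
case: (boolP [exists P, room P && (c @: P == setT)]) => [/exists_inP[P rP /eqP cP]|nex].
  by exists P.
pose typed (Q : {set X}) := c @: Q == [set~ i0].
pose s1 := \sum_(P | room P) \sum_(x | (x \in P) && typed (P :\ x)) 1.
pose s2 := \sum_(Q | typed Q && (#|Q|.+1 == #|I|))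
             \sum_(x | (x \notin Q) && dominant (x |: Q)) 1.
have s12 : s1 = s2.
  rewrite /s1 /s2 !pair_big_dep /=.
  (* Toggling the marked element is an involution exchanging a room with a door of it; it matches
     the pairs counted by [s1] with those counted by [s2]. *)
  pose h (z : {set X} * X) :=
    (if z.2 \in z.1 then z.1 :\ z.2 else z.2 |: z.1, z.2).
  have hK : involutive h.
    move=> [P x]; rewrite /h /=; case: (boolP (x \in P)) => xP.
      by rewrite !inE eqxx /= setD1K.
    by rewrite setU11 setU1K.
  rewrite (reindex_inj (can_inj hK)) /=; apply: eq_bigl => -[Q x] /=.
  rewrite /h /=; case: (boolP (x \in Q)) => xQ /=.
    by rewrite !inE eqxx /= !andbF.
  rewrite setU11 /= setU1K //= /room cardsU1 xQ add1n.
  by case: (dominant _); case: (typed _); rewrite ?andbT ?andbF.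
have even1 : ~~ odd s1.
  rewrite /s1; elim/big_ind: _ => // [x y|P rP]; first by rewrite oddD => /negPf-> /negPf->.
  rewrite sum1dep_card odd_typed_doors //; apply: contra nex => cP.
  by apply/exists_inP; exists P.
pose Q0 := e @: [set~ i0].
have einj := can_inj ce.
have cardQ0 : #|Q0|.+1 = #|I|.
  by rewrite card_imset // (cardsCs [set~ i0]) setCK cards1 subn1 prednK // ltnW.
have tQ0 : typed Q0.
  rewrite /typed -imset_comp (eq_imset (g := id)) ?imset_id //.
have ex_m (Q : {set X}) : Q != set0 ->
    exists m, (forall i, m i \in Q) /\ (forall i x, x \in Q -> rk i (m i) <= rk i x).
  move=> /set0Pn[x0 x0Q]; exists (fun i => [arg min_(y < x0 in Q) rk i y]).
  by split=> i; case: arg_minnP.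
have Qn0 (Q : {set X}) : #|Q|.+1 = #|I| -> Q != set0.
  by move=> cQ; rewrite -card_gt0 -ltnS cQ.
have [z0 z0P] := T0.
have room0 : #|[set x | (x \notin Q0) && dominant (x |: Q0)]| = 1.
  have domQ0 : dominant Q0.
    apply/dominantP => y; case: (boolP (y \in codom e)) => [/codomP[j ->]|yT].
      by exists j => x _; case: (eqVneq x (e j)) => [->//|/e_min/ltnW].
    by exists i0 => _ /imsetP[j + ->]; rewrite !inE => /(e_max yT)/ltnW.
  have [m [mQ mmin]] := ex_m _ (Qn0 _ cardQ0).
  have mE i : i != i0 -> m i = e i.
    move=> ii0; apply/eqP/negPn/negP => /e_min; rewrite ltnNge mmin //.
    by apply: imset_f; rewrite !inE.
  (* One of the two shared orders must be [i0], since [m] agrees with the injective [e] elsewhere.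
     Dropping the condition at [i0] leaves one that every genuine element meets. Dropping the one at
     [b] instead requires [y] to exceed [e b] in the order [i0]: then [y] is a slack element, and
     none qualifies. *)
  have key a b : a != b -> m a = m b -> a = i0 ->
    [exists y, [forall i, (i != a) ==> (rk i (m i) < rk i y)]] /\
    ~~ [exists y, [forall i, (i != b) ==> (rk i (m i) < rk i y)]].
    move=> + + ai0; subst a; rewrite eq_sym => bi0 mab; split.
      apply/existsP; exists z0; apply/forall_inP => i ii0; rewrite mE //.
      by apply: e_min; apply: contraNneq z0P => ->; apply: codom_f.
    apply/negP => /existsP[y /forall_inP hy].
    have := hy i0; rewrite eq_sym mab mE // => /(_ bi0) yb.
    case: (boolP (y \in codom e)) => [/codomP[j yj]|yT]; last first.
      by have := e_max yT bi0; rewrite ltnNge ltnW.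
    have ji0 : j != i0.
      apply/negP => /eqP ji0; have : e b != e i0 by rewrite (inj_eq einj).
      by move=> /e_min; rewrite -ji0 -yj ltnNge ltnW // ji0.
    case: (eqVneq j b) => [jb|jb]; first by rewrite yj jb ltnn in yb.
    by have := hy _ jb; rewrite mE // yj ltnn.
  have [a [b [ab mab ->]]] := door_rooms domQ0 (esym cardQ0) mQ mmin.
  case: (eqVneq a i0) => [ai0|ai0].
    by have [-> /negPf->] := key _ _ ab mab ai0.
  case: (eqVneq b i0) => [bi0|bi0].
    by rewrite eq_sym in ab; have [-> /negPf->] := key _ _ ab (esym mab) bi0.
  by move: mab; rewrite !mE // => /einj abE; rewrite abE eqxx in ab.
have room2 Q : typed Q -> #|Q|.+1 = #|I| -> Q != Q0 ->
    ~~ odd #|[set x | (x \notin Q) && dominant (x |: Q)]|.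
  move=> tQ cQ QQ0; case: (boolP (dominant Q)) => domQ; last first.
    rewrite (_ : [set _ | _] = set0) ?cards0 //; apply/setP => x; rewrite !inE.
    apply/negbTE; rewrite negb_and; apply/orP; right; apply: contra domQ.
    exact/dominantS/subsetUr.
  (* A door of these colours made only of slack elements is [Q0], so any other contains a genuine
     element [z]. *)
  have [z zQ zT] : exists2 z, z \in Q & z \notin codom e.
    apply/exists_inP; apply: contraNT QQ0; rewrite negb_exists_in => /forall_inP h.
    have {}h x : x \in Q -> exists i, x = e i by move=> /h/negPn/codomP.
    apply/eqP/setP => x; apply/idP/imsetP.
      move=> xQ; have [i xi] := h _ xQ; exists i => //.
      by rewrite -(eqP tQ) -(ce i) -xi imset_f.
    move=> [i]; rewrite -(eqP tQ) => /imsetP[y yQ ->] ->.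
    by have [j yj] := h _ yQ; rewrite yj ce -yj.
  have [m [mQ mmin]] := ex_m _ (Qn0 _ cQ).
  have [a [b [_ _ ->]]] := door_rooms domQ (esym cQ) mQ mmin.
  (* The slack [e j] works: in each order [i != j] it lies above [z], hence above the minimum. Both
     counts are then 1 and the door lies in two rooms. *)
  have ex j : [exists y, [forall i, (i != j) ==> (rk i (m i) < rk i y)]].
    apply/existsP; exists (e j); apply/forall_inP => i ij.
    by apply: leq_ltn_trans (e_max (i := i) (j := j) zT _); rewrite 1?eq_sym // mmin.
  by rewrite !ex.
case/negP: even1; rewrite s12 /s2 (bigD1 Q0) ?tQ0 ?cardQ0 ?eqxx //=.
rewrite sum1dep_card room0 oddD /=.
elim/big_ind: _ => // [x y|Q /andP[/andP[tQ /eqP cQ] QQ0]].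
  by rewrite oddD; move: (odd x) (odd y) => [] [].
by rewrite sum1dep_card room2.
Qed.
End Sperner.
End Scarf.

(** * Small colourful sets of integer points in a dilated simplex *)

Section Grid.
Context (I : finType) (m : nat).

Definition gridpt := {x : {ffun I -> 'I_m.+1} | \sum_i x i == m}.

Definition gcoord (x : gridpt) (i : I) : nat := val x i.

Lemma gcoord_sum (x : gridpt) : \sum_i gcoord x i = m.
Proof. exact/eqP/(valP x). Qed.

Lemma gridpt_of (f : I -> nat) : \sum_i f i = m -> exists x, forall i, gcoord x i = f i.
Proof.
move=> fm; have fle i : f i < m.+1 by rewrite ltnS -fm (bigD1 i) //= leq_addr.
pose g : {ffun I -> 'I_m.+1} := [ffun i => Ordinal (fle i)].
have h : \sum_i g i == m.
  by apply/eqP; rewrite -[RHS]fm; apply: eq_bigr => i _; rewrite ffunE.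
exists (exist (fun g : {ffun I -> 'I_m.+1} => is_true (\sum_i g i == m)) g h) => i.
by rewrite /gcoord /= ffunE.
Qed.

(* Order by the coordinate [i], ties being broken by an enumeration. *)
Definition grk (i : I) (x : gridpt + I) : nat :=
  match x with
  | inl x => (gcoord x i * #|{: gridpt}| + enum_rank x).+1
  | inr j => if j == i then 0 else (m.+1 * #|{: gridpt}| + enum_rank j).+1
  end.

Lemma grk_lt (i j : I) (x : gridpt) : j != i -> grk i (inl x) < grk i (inr j).
Proof.
move=> ji; rewrite /= (negPf ji) ltnS.
have hx := ltn_ord (enum_rank x); have := ltn_ord (val x i); rewrite -/(gcoord x i) => hi.
have : gcoord x i * #|{: gridpt}| <= m * #|{: gridpt}| by rewrite leq_mul2r -ltnS hi orbT.
move=> hm; rewrite mulSn; apply: leq_trans (leq_addr _ _).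
by rewrite -addnS addnC leq_add.
Qed.

Lemma grk_inj (i : I) : injective (grk i).
Proof.
move=> [x|j] [y|k].
- rewrite /= => -[h]; congr inl; apply: enum_rank_inj; apply: ord_inj.
  have := congr1 (modn^~ #|{: gridpt}|) h.
  by rewrite !modnMDl !modn_small.
- move=> h; case: (eqVneq k i) => [ki|ki]; first by move: h; rewrite /= ki eqxx.
  by have := grk_lt x ki; rewrite h ltnn.
- move=> h; case: (eqVneq j i) => [ji|ji]; first by move: h; rewrite /= ji eqxx.
  by have := grk_lt y ji; rewrite h ltnn.
- rewrite /=; case: (eqVneq j i) => [->|ji]; case: (eqVneq k i) => [->|ki] // -[/addnI h].
  by congr inr; apply/enum_rank_inj/ord_inj.
Qed.

(** The genuine points of a colourful room form [P]. A colour borne only by a slack element is the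
    second alternative: the points then lie near the face where that coordinate vanishes. Dominance
    makes the coordinate minima nearly exhaust the total [m], which leaves a slack of at most [#|I|]
    in each coordinate. *)
Lemma sperner_grid (c : gridpt -> I) : 1 < #|I| ->
  exists P : {set gridpt}, [/\ P != set0,
    forall x y i, x \in P -> y \in P -> gcoord x i <= gcoord y i + #|I| &
    forall i, (exists2 x, x \in P & c x = i) \/
              (forall x, x \in P -> gcoord x i <= #|I|)].
Proof.
move=> I1; have /card_gt0P[i0 _] : 0 < #|I| by rewrite ltnW.
have [x0 _] : exists x : gridpt, forall i, gcoord x i = (i == i0) * m.
  apply: gridpt_of; rewrite -big_distrl /= (bigD1 i0) //= eqxx big1 ?addn0 ?mul1n //.
  by move=> i /negPf->.
pose c' (x : gridpt + I) := match x with inl x => c x | inr i => i end.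
have emin i (x : gridpt + I) : x != inr i -> grk i (inr i) < grk i x.
  by case: x => [x|j] ne /=; rewrite eqxx //; have /negPf-> : j != i by [].
have emax i j (x : gridpt + I) : x \notin codom inr -> j != i -> grk i x < grk i (inr j).
  by case: x => [x _|k]; [exact: grk_lt|rewrite codom_f].
have [||P /andP[_ /dominantP domP] cP] := @colourful_room _ _ grk grk_inj inr c' _ emin emax _ I1.
- by [].
- by exists (inl x0); apply/negP => /codomP[].
have colP i : exists2 x, x \in P & c' x = i.
  by have : i \in c' @: P by [rewrite cP]; move=> /imsetP[x]; exists x.
pose C := [set i | inr i \notin P].
(* A slack element is lowest in its own order, so an order witnessing dominance at a genuine point
   has its slack outside the room. *)
have [i1 i1C] : exists i1, i1 \in C.
  have [i hi] := domP (inl x0); exists i; rewrite inE; apply/negP => /hi.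
  by rewrite leqNgt emin.
pose Q := [set x : gridpt | inl x \in P].
have colC i : i \in C -> exists2 x, x \in Q & c x = i.
  have [[x|j] xP xi] := colP i; rewrite inE; first by exists x; rewrite ?inE.
  by move: xi => /= <-; rewrite xP.
have [q1 q1Q _] := colC _ i1C.
pose u i := gcoord [arg min_(x < q1 in Q) gcoord x i] i.
have uP i x : x \in Q -> u i <= gcoord x i.
  by rewrite /u; case: arg_minnP => // y yQ hy /hy.
have uex i : exists2 x, x \in Q & gcoord x i = u i.
  by rewrite /u; case: arg_minnP => // y yQ hy; exists y.
(* Otherwise a grid point with larger coordinates would contradict dominance. *)
have key : m < \sum_(i in C) (u i).+1.
  rewrite ltnNge; apply/negP => le.
  (* The coordinate [i1] absorbs the remainder, so that the coordinates sum to [m]. *)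
  pose rest := m - \sum_(i in C) (u i).+1.
  have [|y yE] := @gridpt_of (fun i => (i \in C) * (u i).+1 + (i == i1) * rest).
    rewrite big_split /= -big_distrl /= (bigD1 i1 (F := fun i => nat_of_bool (i == i1))) //= eqxx.
    rewrite (big1 _ (fun i => i != i1)) ?addn0 ?mul1n => [|i /negPf->//].
    rewrite -[X in _ = X](subnKC le); congr (_ + _).
    rewrite [RHS]big_mkcond /=; apply: eq_bigr => i _.
    by case: (i \in C); rewrite ?mul1n ?mul0n.
  have [i hi] := domP (inl y).
  have iC : i \in C by rewrite inE; apply/negP => /hi; rewrite leqNgt emin.
  have [x xQ xu] := uex i; have := hi (inl x); rewrite inE in xQ => /(_ xQ).
  rewrite /= ltnS yE iC mul1n xu leqNgt mulnDl mulSn => /negP[].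
  do 2 apply: leq_trans (leq_addr _ _).
  by rewrite -addnS addnC leq_add2r.
have sumC x : \sum_(i in C) gcoord x i + \sum_(i in ~: C) gcoord x i = m.
  rewrite -[RHS](gcoord_sum x) [RHS](bigID [in C]) /=; congr (_ + _).
  by apply: eq_bigl => i; rewrite inE.
have cC : #|C| <= #|I| := max_card _.
have sumu : \sum_(i in C) (u i).+1 = \sum_(i in C) u i + #|C|.
  by rewrite -sum1_card -big_split /=; apply: eq_bigr => i _; rewrite addn1.
have upC x i : x \in Q -> i \in C -> gcoord x i <= u i + #|I|.
  move=> xQ iC; have := sumC x; move: key; rewrite sumu (bigD1 i) //=.
  rewrite (bigD1 i (P := [in C])) //=.
  have : \sum_(j in C | j != i) u j <= \sum_(j in C | j != i) gcoord x j.
    by apply: leq_sum => j _; exact: uP.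
  move: cC; set a := (\sum_(_ in _ | _) u _); set b := (\sum_(_ in _ | _) gcoord x _).
  set p := #|C|; set q := #|I|; set z := (\sum_(_ in ~: C) _).
  by clearbody a b p q z; move: (u i) (gcoord x i); lia.
have upnC x i : x \in Q -> i \notin C -> gcoord x i <= #|I|.
  move=> xQ iC; have := sumC x; move: key; rewrite sumu (bigD1 i (P := [in ~: C])) ?in_setC //=.
  have : \sum_(j in C) u j <= \sum_(j in C) gcoord x j by apply: leq_sum => j _; exact: uP.
  move: cC; set a := (\sum_(_ in C) u _); set b := (\sum_(_ in C) gcoord x _).
  set p := #|C|; set q := #|I|; set z := (\sum_(_ in ~: C | _) _).
  by clearbody a b p q z; move: (gcoord x i); lia.
exists Q; split; [by apply/set0Pn; exists q1| |].
  move=> x y i xQ yQ; case: (boolP (i \in C)) => iC.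
    by rewrite (leq_trans (upC _ _ xQ iC)) // leq_add2r uP.
  by rewrite (leq_trans (upnC _ _ xQ iC)) // leq_addl.
move=> i; case: (boolP (i \in C)) => iC; first by left; exact: colC.
by right=> x xQ; exact: upnC.
Qed.
End Grid.

Require Import Defs.
From mathcomp Require Import all_boot all_order all_algebra.
From mathcomp Require Import all_classical all_reals all_analysis.
From mathcomp Require Import measurable_realfun ring lra.

Import Order.TTheory GRing.Theory Num.Theory.
Import numFieldNormedType.Exports.

Local Open Scope classical_set_scope.
Local Open Scope ring_scope.

(* The probability library also defines a [pmf]. *)
Local Notation pmf := Defs.pmf.

(** * Brouwer's theorem *)

Lemma mx_norm_leP (R : realType) (m n : nat) (x : 'M[R]_(m, n)) (e : R) :
  0 <= e -> reflect (forall i j, `|x i j| <= e) (`|x| <= e).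
Proof.
move=> e0; rewrite [X in X <= e]mx_normrE; apply: (iffP idP) => [h i j|h].
  apply: le_trans h.
  exact: (le_bigmax_cond _ (fun ij : 'I_m * 'I_n => `|x ij.1 ij.2|) (j := (i, j))).
by apply: bigmax_le => // -[i j] _; exact: h.
Qed.

Lemma continuous_sum (U : topologicalType) (R : realType) (J : Type) (l : seq J)
    (P : pred J) (F : J -> U -> R) :
  (forall j, P j -> continuous (F j)) ->
  continuous (fun u => \sum_(j <- l | P j) F j u).
Proof.
move=> cF u; elim: l => [|j l IHl].
  by under eq_fun do rewrite big_nil; exact: cvg_cst.
under eq_fun do rewrite big_cons.
by case: ifP => // /cF Pj; apply: cvgD => //; exact: Pj.
Qed.

Section Brouwer.
Context (R : realType).

Definition simplex (n : nat) : set 'rV[R]_n :=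
  [set x | (forall i, 0 <= x 0 i) /\ \sum_i x 0 i = 1].
Arguments simplex n : clear implicits.

Lemma compact_simplex (n : nat) : compact (simplex n).
Proof.
have -> : simplex n = [set v : 'rV[R]_n | forall i, `[0 : R, 1]%classic (v ord0 i)] `&`
    (fun v : 'rV[R]_n => \sum_i v 0 i) @^-1` [set 1].
  apply/seteqP; split=> [x [x0 x1]|x [x01 x1]]; split=> //.
    move=> i; rewrite /= in_itv /= x0 -x1 (bigD1 i) //= lerDl.
    by apply: sumr_ge0.
  by move=> i; have := x01 i; rewrite /= in_itv /= => /andP[].
apply: compact_closedI; last first.
  apply: preimage_closed; last exact: closed_eq.
  by move=> x _; apply: continuous_sum => i _; exact: coord_continuous.
apply: (@rV_compact R n (fun=> `[0, 1]%classic)) => i; exact: segment_compact.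
Qed.

Section Approx.
Context (n : nat) (f : 'rV[R]_n.+2 -> 'rV[R]_n.+2).
Hypothesis f_simplex : forall x, simplex n.+2 x -> simplex n.+2 (f x).

(** A grid point [x] is coloured by a coordinate [i] with [x i <= f x i], which exists because both
    points have total mass 1. In a small colourful set each colour has a nearby witness; a missing
    colour means that the coordinate itself is at most [e], and [f] is nonnegative. The dimension
    [n.+2] provides the two colours that [sperner_grid] asks for. *)
Lemma brouwer_approx (m : nat) :
  let e : R := n.+2%:R / m.+1%:R in
  exists2 z, simplex n.+2 z & forall i, exists z', [/\ simplex n.+2 z',
    `|z - z'| <= e & z' 0 i - f z' 0 i <= e].
Proof.
move=> e; pose pt (x : gridpt 'I_n.+2 m.+1) : 'rV[R]_n.+2 :=
  \row_i ((gcoord x i)%:R / m.+1%:R).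
have pt_simplex x : simplex n.+2 (pt x).
  split=> [i|]; first by rewrite mxE divr_ge0.
  under eq_bigr do rewrite mxE.
  by rewrite -mulr_suml -natr_sum gcoord_sum divff // pnatr_eq0.
have colour (x : gridpt 'I_n.+2 m.+1) : exists i, pt x 0 i <= f (pt x) 0 i.
  apply/not_existsP => h.
  have : \sum_i f (pt x) 0 i < \sum_i pt x 0 i.
    apply: ltr_sum; first by apply/hasP; exists 0; rewrite ?mem_index_enum.
    by move=> i _; rewrite ltNge; apply/negP/h.
  by have [_ ->] := f_simplex (pt_simplex x); have [_ ->] := pt_simplex x; rewrite ltxx.
have [c hc] := choice colour.
have [|P [/set0Pn[x0 x0P] close cP]] := sperner_grid c; first by rewrite card_ord.
rewrite card_ord in close cP.
have le_e (a b : nat) : (a <= b + n.+2)%N -> a%:R / m.+1%:R <= b%:R / m.+1%:R + e.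
  by move=> ab; rewrite -mulrDl ler_pM2r ?invr_gt0 ?ltr0n // -natrD ler_nat.
have e0 : 0 <= e by rewrite divr_ge0.
exists (pt x0) => // i.
have dist x : x \in P -> `|pt x0 - pt x| <= e.
  move=> xP; apply/mx_norm_leP => // i0 j; rewrite !mxE ler_norml.
  have := le_e _ _ (close _ _ j x0P xP); have := le_e _ _ (close _ _ j xP x0P).
  by move=> h1 h2; rewrite lerNl opprB !lerBlDl h1 h2.
case: (cP i) => [[x xP cx]|h].
  exists (pt x); split=> //; first exact: dist.
  rewrite (@le_trans _ _ 0) // subr_le0 -cx; exact: hc.
exists (pt x0); split=> //; first exact: dist.
rewrite lerBlDr mxE; apply: (@le_trans _ _ e).
  by have := @le_e _ 0 (h _ x0P); rewrite mul0r add0r.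
by rewrite lerDl; have [-> //] := f_simplex (pt_simplex x0).
Qed.

End Approx.

(** A cluster point [x] of the approximate solutions satisfies [x i <= f x i] in every coordinate;
    as both sides sum to 1, equality follows. The simplex with one vertex is treated apart. *)
Theorem brouwer_simplex (n : nat) (f : 'rV[R]_n.+1 -> 'rV[R]_n.+1) :
  (forall x, simplex n.+1 x -> simplex n.+1 (f x)) -> continuous f ->
  exists2 x, simplex n.+1 x & f x = x.
Proof.
case: n f => [|n] f f_simplex cf.
  pose x : 'rV[R]_1 := const_mx 1.
  have xs : simplex 1 x by split=> [i|]; rewrite ?big_ord1 mxE.
  exists x => //; apply/rowP => i; have [_] := f_simplex x xs.
  by rewrite ord1 big_ord1 mxE.
have ex m : exists z, simplex n.+2 z /\ forall i, exists z', [/\ simplex n.+2 z',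
    `|z - z'| <= n.+2%:R / m.+1%:R & z' 0 i - f z' 0 i <= n.+2%:R / m.+1%:R].
  by have [z zs hz] := brouwer_approx f_simplex m; exists z.
have [z zP] := choice ex.
have [|x [xs cx]] := @compact_simplex n.+2 (z m @[m --> \oo]) _.
  by exists 0%N => // m _; have [zs _] := zP m.
exists x => //.
have key i : x 0 i <= f x 0 i.
  rewrite leNgt; apply/negP => lt_i.
  pose eta := (x 0 i - f x 0 i) / 2.
  have eta0 : 0 < eta by rewrite divr_gt0 // subr_gt0.
  pose g (y : 'rV[R]_n.+2) : R := y 0 i - f y 0 i.
  have : \forall y \near x, eta < g y.
    have cc : continuous (fun y : 'rV[R]_n.+2 => y 0 i : R) by exact: coord_continuous.
    have cfi : (f y 0 i : R) @[y --> x] --> f x 0 i.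
      exact: (@continuous_comp _ _ _ f (fun y : 'rV[R]_n.+2 => y 0 i : R) x (cf x) (cc _)).
    have cg : g y @[y --> x] --> g x by exact: (cvgB (cc x) cfi).
    by apply: (cvgr_gt _ cg); rewrite /g /eta; lra.
  move=> /nbhs_ballP[d /= d0 hd].
  (* Once [m.+1] exceeds [1 / k], the error is below [d / 2], which keeps the witness [z'] in the
     ball of radius [d], and below [eta], which contradicts the gap on that ball. *)
  pose k := Num.min (d / 2) eta / n.+2%:R.
  have k0 : 0 < k by rewrite divr_gt0 // lt_min eta0 divr_gt0.
  pose small y := exists2 m, y = z m & n.+2%:R / m.+1%:R < Num.min (d / 2) eta.
  have d2 : 0 < d / 2 by rewrite divr_gt0.
  have [|y [[m -> em] bxy]] := cx small (ball x (d / 2)) _ (nbhsx_ballx x _ d2).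
    have [N _ hN] := near_infty_natSinv_lt (PosNum k0).
    exists N => // m Nm; exists m => //.
    by rewrite mulrC -ltr_pdivlMr ?ltr0n //; exact: hN.
  move: em; rewrite lt_min => /andP[e1 e2].
  have [_ /(_ i)[z' [_ zz' gz']]] := zP m.
  have : eta < z' 0 i - f z' 0 i.
    apply: hd; rewrite -ball_normE /ball_ /= (splitr d).
    apply: le_lt_trans (ler_distD (z m) _ _) _; rewrite ltrD //.
      by move: bxy; rewrite -ball_normE.
    exact: le_lt_trans e1.
  by rewrite ltNge (le_trans gz') // ltW.
have [_ s1] := xs; have [_ s2] := f_simplex x xs.
apply/rowP => i; apply/eqP; rewrite eq_le key andbT.
have := s2; rewrite -[in RHS]s1 (bigD1 i) // [RHS](bigD1 i) //= => e.
have : \sum_(j < n.+2 | j != i) x 0 j <= \sum_(j < n.+2 | j != i) f x 0 j.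
  by apply: ler_sum => j _; exact: key.
by lra.
Qed.
End Brouwer.

Lemma continuous_row (U : topologicalType) (R : realType) (n : nat)
    (g : 'I_n.+1 -> U -> R) :
  (forall i, continuous (g i)) ->
  continuous (fun u => \row_i g i u : 'rV[R]_n.+1).
Proof.
move=> cg u; apply/cvgrPdist_le => /= e e0.
have : \forall v \near u, forall j, `|g j u - g j v| <= e.
  by apply: filter_forall => j; have /cvgrPdist_le/(_ e e0) := cg j u.
apply: filterS => v h; apply/mx_norm_leP => [|i j]; first exact: ltW.
rewrite !mxE; exact: h.
Qed.

Lemma continuous_fsbig (U : topologicalType) (R : realType) (J : choiceType)
    (S : set J) (F : J -> U -> R) :
  finite_set S -> (forall j, S j -> continuous (F j)) ->
  continuous (fun u => \sum_(j \in S) F j u).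
Proof.
move=> finS cF; pose s := finmap.enum_fset (fset_set S).
have -> : (fun u => \sum_(j \in S) F j u) = (fun u => \sum_(j <- s | j \in s) F j u).
  by apply/funext => u; rewrite fsbig_finite // big_seq.
apply: continuous_sum => j; rewrite in_fset_set // => /set_mem; exact: cF.
Qed.

(** * Fixed points on finite products of simplices *)

Section Retract.
Context (R : realType) (T : choiceType) (S : set T) (e : T).
Hypotheses (finS : finite_set S) (eS : S e).

(* A continuous retraction onto the simplex; the denominator is at least 1. *)
Definition pmf_retract (v : T -> R) (x : T) : R :=
  let s := \sum_(y \in S) `|v y| in
  if x \in S then (`|v x| + `|1 - s| * (x == e)%:R) / (s + `|1 - s|) else 0.

Lemma pmf_retract_den (v : T -> R) :
  0 < \sum_(y \in S) `|v y| + `|1 - \sum_(y \in S) `|v y| |.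
Proof. by set s := \sum_(y \in S) _; have := ler_norm (1 - s); lra. Qed.

Lemma pmf_retractP (v : T -> R) : pmf S (pmf_retract v).
Proof.
rewrite /pmf_retract; split.
- move=> y; case: ifP => // _; apply: divr_ge0; last exact/ltW/pmf_retract_den.
  by apply: addr_ge0 => //; apply: mulr_ge0.
- by move=> y; case: ifPn => // /set_mem.
- have := pmf_retract_den v; set s := \sum_(y \in S) `|v y| => den0.
  transitivity (\sum_(x \in S) (`|v x| + `|1 - s| * (x == e)%:R) / (s + `|1 - s|)).
    by apply: eq_fsbigr => x ->.
  have : \sum_(i \in S) ((i == e)%:R : R) = 1.
    transitivity (\sum_(i \in [set e]) ((i == e)%:R : R)); last by rewrite fsbig_set1 eqxx.
    apply/esym/fsbig_widen; first by move=> _ ->.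
    by move=> x [_ /= /eqP/negPf ->].
  rewrite !fsbig_finite //= -mulr_suml big_split /= -mulr_sumr => ->.
  by rewrite mulr1 -fsbig_finite // divff // gt_eqF.
Qed.

Lemma pmf_retract_id (v : T -> R) x :
  (forall y, S y -> 0 <= v y) -> \sum_(y \in S) v y = 1 -> S x ->
  pmf_retract v x = v x.
Proof.
move=> v0 v1 Sx; rewrite /pmf_retract mem_set //.
have -> : \sum_(y \in S) `|v y| = 1.
  by rewrite -v1; apply: eq_fsbigr => y /set_mem/v0/ger0_norm.
by rewrite subrr normr0 addr0 mul0r addr0 divr1 ger0_norm // v0.
Qed.

Lemma continuous_pmf_retract (U : topologicalType) (v : U -> T -> R) x :
  (forall y, S y -> continuous (fun u => v u y)) ->
  continuous (fun u => pmf_retract (v u) x).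
Proof.
move=> cv; rewrite /pmf_retract; case: (boolP (x \in S)) => [/set_mem Sx|_]; last first.
  by move=> u; exact: cvg_cst.
have cs : continuous (fun u => \sum_(y \in S) `|v u y| : R).
  apply: continuous_fsbig => // y Sy u.
  by apply: cvg_norm; exact: cv.
have cd : continuous (fun u => `|1 - \sum_(y \in S) `|v u y| | : R).
  by move=> u; apply: cvg_norm; apply: cvgB; [exact: cvg_cst|exact: cs].
move=> u; apply: cvgM.
  apply: cvgD; first by apply: cvg_norm; exact: cv.
  by apply: cvgM; [exact: cd|exact: cvg_cst].
apply: cvgV; first by rewrite gt_eqF // pmf_retract_den.
by apply: cvgD; [exact: cs|exact: cd].
Qed.
End Retract.

(* All the simplices are embedded, after division by [N + 1], in the simplex whose
   vertices are the pairs [(k, x)] with [S k x]. *)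
Theorem fixpoint_pmf (R : realType) (T : choiceType) (N : nat) (S : nat -> set T)
    (F : (nat -> T -> R) -> nat -> T -> R) :
  (forall k, (k <= N)%N -> finite_set (S k)) ->
  (forall k, (k <= N)%N -> S k !=set0) ->
  (forall mu, (forall k, (k <= N)%N -> pmf (S k) (mu k)) ->
     forall k, (k <= N)%N ->
     (forall x, S k x -> 0 <= F mu k x) /\ \sum_(x \in S k) F mu k x = 1) ->
  (forall (U : topologicalType) (mu : U -> nat -> T -> R),
     (forall u k, (k <= N)%N -> pmf (S k) (mu u k)) ->
     (forall k x, (k <= N)%N -> continuous (fun u => mu u k x)) ->
     forall k x, (k <= N)%N -> S k x -> continuous (fun u => F (mu u) k x)) ->
  exists2 mu, (forall k, (k <= N)%N -> pmf (S k) (mu k)) &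
    forall k x, (k <= N)%N -> S k x -> F mu k x = mu k x.
Proof.
move=> finS neS hF cF.
have ex_e k : exists e, (k <= N)%N -> S k e.
  case: (leqP k N) => [/neS[e Se]|]; first by exists e.
  by have [e _] := neS 0%N (leq0n N); exists e.
have [e eS] := choice ex_e.
pose s k := finmap.enum_fset (fset_set (S k)).
have memS k x : (k <= N)%N -> (x \in s k) = (x \in S k).
  by move=> kN; rewrite in_fset_set //; exact: finS.
pose L := [seq (k, x) | k <- iota 0 N.+1, x <- s k].
have memL k x : (k <= N)%N -> S k x -> (k, x) \in L.
  move=> kN Sx; apply/allpairsPdep; exists k, x; split=> //.
    by rewrite mem_iota.
  by rewrite memS // mem_set.
have uL : uniq L.
  apply: allpairs_uniq_dep.
  - exact: iota_uniq.
  - by move=> k _; exact: finmap.fset_uniq.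
  - by move=> p q _ _; case: p q => [i x] [j y] /= h; case: h => -> ->.
have [l sL] : exists l, size L = l.+1.
  case: (L) (memL 0%N (e 0%N) (leq0n N) (eS _ (leq0n N))) => // a L' _; by exists (size L').
pose z0 := (0%N, e 0%N).
have LP z : z \in L -> (z.1 <= N)%N /\ S z.1 z.2.
  move=> /allpairsPdep[k [x [kN xs ->]]] /=; move: kN; rewrite mem_iota => kN.
  by split=> //; apply: set_mem; rewrite -memS.
pose ix k x : 'I_l.+1 := inord (index (k, x) L).
have ixK k x : (k <= N)%N -> S k x -> nth z0 L (ix k x) = (k, x).
  move=> kN Sx; rewrite inordK; last by rewrite -sL index_mem memL.
  by rewrite nth_index // memL.
pose c : R := N.+1%:R.
have c0 : c != 0 by rewrite pnatr_eq0.
(* Thanks to the retraction every [w], inside the simplex or not, yields probability mass functions,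
   so the self-map [f] below is defined and continuous on the whole space. *)
pose mu (w : 'rV[R]_l.+1) k := pmf_retract (S k) (e k) (fun x => c * w 0 (ix k x)).
have muP w k : (k <= N)%N -> pmf (S k) (mu w k).
  by move=> kN; exact: (pmf_retractP (finS _ kN) (eS _ kN)).
have cmu k x : (k <= N)%N -> continuous (fun w => mu w k x).
  move=> kN; apply: continuous_pmf_retract; first exact: finS.
  move=> y Sy w.
  have cc : continuous (fun v : 'rV[R]_l.+1 => v 0 (ix k y) : R).
    exact: coord_continuous.
  exact: (cvgM (cvg_cst c) (cc w)).
pose f w : 'rV[R]_l.+1 := \row_i (F (mu w) (nth z0 L i).1 (nth z0 L i).2 / c).
have nthL (i : 'I_l.+1) : nth z0 L i \in L by rewrite mem_nth // sL.
have [w _ fw] : exists2 w, @simplex R l.+1 w & f w = w.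
  apply: brouwer_simplex.
    move=> w _; split=> [i|].
      rewrite mxE divr_ge0 // ?ler0n //.
      have [kN Sx] := LP _ (nthL i); by have [h _] := hF _ (muP w) _ kN; exact: h.
    under eq_bigr do rewrite mxE.
    rewrite -mulr_suml -(big_mkord xpredT (fun i => F (mu w) (nth z0 L i).1 (nth z0 L i).2)).
    rewrite -sL -(big_nth z0 xpredT (fun z => F (mu w) z.1 z.2)) big_allpairs_dep /=.
    rewrite (eq_big_seq (fun=> 1)).
      rewrite big_const_seq count_predT -[_ :: _]/(iota 0 N.+1) size_iota iter_addr_0.
      exact: divff.
    move=> k; rewrite -[_ :: _]/(iota 0 N.+1) mem_iota /= => kN.
    have [_] := hF _ (muP w) _ kN; rewrite fsbig_finite; [exact|exact: (finS _ kN)].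
  apply: continuous_row => i w; have [kN Sx] := LP _ (nthL i).
  exact: (cvgM (cF _ mu muP cmu _ _ kN Sx w) (cvg_cst c^-1)).
exists (mu w); first exact: muP.
move=> k x kN Sx; have [F0 F1] := hF _ (muP w) _ kN.
(* At the fixed point the rescaled coordinates are values of [F], hence already a probability mass
   function, and the retraction leaves them unchanged. *)
have wE y : S k y -> c * w 0 (ix k y) = F (mu w) k y.
  by move=> Sy; rewrite -[in LHS]fw mxE ixK //= mulrC divfK.
rewrite /mu pmf_retract_id //.
- by rewrite wE.
- by move=> y Sy; rewrite wE // F0.
- by rewrite -F1; apply: eq_fsbigr => y /set_mem; exact: wE.
Qed.

(** * Entropic minimization *)

Section Gibbs.
Context (R : realType) (T : choiceType) (S : set T) (eps : R) (c : T -> R).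
Hypotheses (finS : finite_set S) (S0 : S !=set0) (eps0 : 0 < eps).

Definition partition_fun : R := \sum_(y \in S) expR (- (c y / eps)).
Definition gibbs (y : T) : R :=
  if y \in S then expR (- (c y / eps)) / partition_fun else 0.
Definition free_energy (q : T -> R) : R :=
  \sum_(y \in S) q y * c y + eps * entropy S q.

Lemma fsumE (f : T -> R) :
  \sum_(y \in S) f y = \sum_(y <- finmap.enum_fset (fset_set S) | y \in S) f y.
Proof.
rewrite fsbig_finite // big_seq_cond [RHS]big_seq_cond; apply: eq_bigl => y.
by rewrite andbT in_fset_set // andbb.
Qed.

Lemma partition_fun_gt0 : 0 < partition_fun.
Proof.
have [y Sy] := S0; rewrite /partition_fun fsumE.
have yS : y \in finmap.enum_fset (fset_set S) by rewrite in_fset_set // mem_set.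
rewrite big_mkcond /= (bigD1_seq y) //= ?finmap.fset_uniq // mem_set //.
by rewrite ltr_pwDl ?expR_gt0 // sumr_ge0 // => z _; case: ifP => // _; exact: expR_ge0.
Qed.

Lemma gibbs_gt0 y : S y -> 0 < gibbs y.
Proof.
by move=> Sy; rewrite /gibbs mem_set // divr_gt0 ?expR_gt0 ?partition_fun_gt0.
Qed.

Lemma gibbs_pmf : pmf S gibbs.
Proof.
split=> [y|y|].
- case: (boolP (y \in S)) => [/set_mem Sy|/negPf yS]; first exact/ltW/gibbs_gt0.
  by rewrite /gibbs yS.
- by rewrite /gibbs; case: ifPn => // /set_mem.
- transitivity (\sum_(y \in S) expR (- (c y / eps)) / partition_fun).
    by apply: eq_fsbigr => y yS; rewrite /gibbs yS.
  rewrite fsumE -mulr_suml -fsumE divff // gt_eqF //; exact: partition_fun_gt0.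
Qed.

(** The last sum is the relative entropy of [q] with respect to the Gibbs weights. The identity is
    termwise, once the constant [ln partition_fun] is spread over the sum by means of the total mass
    1. *)
Lemma free_energyE (q : T -> R) : \sum_(y \in S) q y = 1 ->
  free_energy q = - eps * ln partition_fun +
    eps * \sum_(y \in S) q y * (ln (q y) - ln (gibbs y)).
Proof.
move=> q1; rewrite /free_energy /entropy -[in RHS](mulr1 (- eps * _)) -[in RHS]q1.
rewrite !fsumE !mulr_sumr -!big_split /=; apply: eq_bigr => y /set_mem Sy.
rewrite {1}/gibbs mem_set // lnM ?posrE ?expR_gt0 ?invr_gt0 ?partition_fun_gt0 //.
rewrite lnV ?posrE ?partition_fun_gt0 // expRK.
by field; rewrite gt_eqF.
Qed.

(* The pointwise form of the nonnegativity of relative entropy. *)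
Lemma kl_term (q g : R) : 0 <= q -> 0 < g -> q - g <= q * (ln q - ln g) ?= iff (q == g).
Proof.
move=> q0 g0; apply/leifP; case: eqVneq => [->|qg]; first by rewrite !subrr mulr0.
move: q0; rewrite le_eqVlt => /orP[/eqP <-|q0].
  by rewrite mul0r sub0r oppr_lt0.
have ne : ln g - ln q != 0.
  by rewrite subr_eq0; apply: contra qg => /eqP/ln_inj-> //; rewrite ?posrE.
(* The strict inequality [1 + t < expR t] at [t = ln g - ln q], multiplied by [q]. *)
have := expR_gt1Dx ne; rewrite expRD expRN !lnK ?posrE // -(ltr_pM2l q0) mulrCA divff ?gt_eqF //.
by lra.
Qed.

(** Since [q] and the Gibbs weights have the same mass, the lower bounds of [kl_term] add up to 0.
    Carrying the equality case through the sum gives uniqueness of the minimizer. *)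
Lemma gibbs_variational (q : T -> R) : pmf S q ->
  - eps * ln partition_fun <= free_energy q ?= iff `[< q = gibbs >].
Proof.
move=> [q0 qS q1]; rewrite free_energyE //.
have [_ _ g1] := gibbs_pmf.
have e0 : \sum_(y \in S) (q y - gibbs y) = 0.
  by rewrite fsumE sumrB -!fsumE q1 g1 subrr.
have le y : y \in S -> q y - gibbs y <= q y * (ln (q y) - ln (gibbs y)) ?= iff (q y == gibbs y).
  by move=> /set_mem Sy; apply: kl_term => //; exact: gibbs_gt0.
pose s := finmap.enum_fset (fset_set S).
have hs : 0 <= \sum_(y \in S) q y * (ln (q y) - ln (gibbs y))
    ?= iff all (fun y => (y \in S) ==> (q y == gibbs y)) s.
  rewrite -[X in X <= _ ?= iff _]e0 !fsumE -/s; elim: s => [|y s IHs].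
    by rewrite !big_nil; split; rewrite ?lexx ?eqxx.
  rewrite !big_cons /=; case: (boolP (y \in S)) => //= yS.
  by apply: leifD => //; exact: le.
split; first by rewrite lerDl; apply: mulr_ge0; [exact: ltW|exact: hs.1].
rewrite -[X in X == _]addr0 (inj_eq (addrI _)) eq_sym mulf_eq0 gt_eqF //= eq_sym hs.2.
apply/allP/asboolP => [h|-> y _]; last by rewrite eqxx implybT.
apply/funext => y; case: (boolP (y \in S)) => yS.
  have /h : y \in s by rewrite in_fset_set.
  by rewrite yS => /eqP.
by rewrite /gibbs (negPf yS) qS // => /mem_set; rewrite (negPf yS).
Qed.

Lemma free_energy_gibbs : free_energy gibbs = - eps * ln partition_fun.
Proof.
by apply/esym/eqP; have [_ ->] := gibbs_variational gibbs_pmf; apply/asboolP.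
Qed.

Lemma inf_free_energy : inf [set free_energy q | q in pmf S] = - eps * ln partition_fun.
Proof.
apply/eqP; rewrite eq_le; apply/andP; split.
  rewrite -free_energy_gibbs; apply: ge_inf; last by exists gibbs => //; exact: gibbs_pmf.
  by exists (- eps * ln partition_fun) => _ [q /gibbs_variational [h _] <-].
apply: lb_le_inf; first by exists (free_energy gibbs), gibbs => //; exact: gibbs_pmf.
by move=> _ [q /gibbs_variational [h _] <-].
Qed.

Lemma argmin_free_energy (q : T -> R) : pmf S q ->
  (forall q', pmf S q' -> free_energy q <= free_energy q') -> q = gibbs.
Proof.
move=> qP qmin; have [le eqE] := gibbs_variational qP.
by apply/asboolP; rewrite -eqE eq_le le -free_energy_gibbs qmin //; exact: gibbs_pmf.
Qed.
End Gibbs.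

(** * Finitely supported measures *)

Section Atomic.
Context (d : measure_display) (T : measurableType d) (R : realType) (J : Type).
Context (s : seq J) (z : J -> T) (w : J -> R).
Hypotheses (w0 : forall j, 0 <= w j) (w1 : \sum_(j <- s) w j = 1).

Lemma atomic_probability : exists P : probability T R,
  (forall U, P U = (\sum_(j <- s) w j * (z j \in U)%:R)%:E) /\
  (forall f : T -> R, measurable_fun setT f -> (forall x, 0 <= f x) ->
    (\int[P]_x (f x)%:E)%E = (\sum_(j <- s) w j * f (z j))%:E).
Proof.
have [j0 _] : exists j0 : J, True.
  case: s w1 => [|j0 _ _]; last by exists j0.
  by rewrite big_nil => /eqP; rewrite eq_sym oner_eq0.
pose m i : measure T R := mscale (NngNum (w0 (nth j0 s i))) \d_(z (nth j0 s i)).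
have muE U : msum m (size s) U = (\sum_(j <- s) w j * (z j \in U)%:R)%:E.
  rewrite /msum (big_nth j0) big_mkord -sumEFin; apply: eq_bigr => i _.
  by rewrite /m /= /mscale /= /dirac indicE EFinM.
(* The normalization only serves to obtain a [probability]: the total mass is already 1. *)
have PE : mnormalize (msum m (size s)) \d_(z j0) = msum m (size s).
  have e1 : msum m (size s) setT = 1%E.
    by rewrite muE; under eq_bigr do rewrite in_setT mulr1; rewrite w1.
  apply/funext => U; rewrite /mnormalize /= e1 /= onee_eq0 /=.
  by rewrite invr1 mule1.
exists (mnormalize (msum m (size s)) \d_(z j0)); split=> [U|f mf f0].
  by rewrite -muE; have /(congr1 (@^~ U)) := PE.
rewrite (eq_measure_integral (msum m (size s))); last first.
  by move=> U _ _; have /(congr1 (@^~ U)) := PE.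
have mf' : measurable_fun setT (fun x => (f x)%:E) by exact/measurable_EFinP.
rewrite ge0_integral_measure_sum //; last by move=> x _; rewrite lee_fin.
rewrite (big_nth j0) big_mkord -sumEFin; apply: eq_bigr => i _.
rewrite ge0_integral_mscale //; last by move=> x _; rewrite lee_fin.
by rewrite integral_dirac // diracT mul1e EFinM.
Qed.
End Atomic.

Section Borel.
Context (R : realType) (n : nat).

Lemma continuous_measurable_Rn (f : 'cV[R]_n -> R) :
  continuous f -> measurable_fun [set: Rn R n] (f : Rn R n -> R).
Proof.
move=> cf; apply: (measurability (@RGenOpens.G R)); first exact: RGenOpens.measurableE.
move=> _ [_ [a [b ->]] <-]; rewrite setTI; apply: sub_sigma_algebra.
by apply: open_comp => // x _; exact: cf.
Qed.

Lemma measurable_norm_Rn : measurable_fun [set: Rn R n] (fun x : 'cV[R]_n => `|x|).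
Proof. by apply: continuous_measurable_Rn => x; exact: norm_continuous. Qed.

(** The product carries the product sigma-algebra rather than a Borel one, so the distance is
    written as a finite maximum of coordinate functions, each measurable on its factor. *)
Lemma measurable_dist_Rn :
  measurable_fun [set: (Rn R n * Rn R n)%type] (fun z => `|(z.1 : 'cV[R]_n) - z.2| : R).
Proof.
have cc i j : measurable_fun [set: Rn R n] (fun v : 'cV[R]_n => v i j : R).
  by apply: continuous_measurable_Rn; exact: coord_continuous.
have -> : (fun z : Rn R n * Rn R n => `|(z.1 : 'cV[R]_n) - z.2| : R) =
    (fun z => \big[Num.max/0]_(ij : 'I_n * 'I_1)
      `|(z.1 : 'cV[R]_n) ij.1 ij.2 - (z.2 : 'cV[R]_n) ij.1 ij.2|).
  apply/funext => z; rewrite [LHS]mx_normrE.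
  by apply: eq_bigr => ij _; rewrite !mxE.
elim: (index_enum _) => [|ij l IHl].
  by under eq_fun do rewrite big_nil; exact: measurable_cst.
under eq_fun do rewrite big_cons.
apply: measurable_maxr => //; apply: measurableT_comp; first exact: normr_measurable.
apply: measurable_funB; apply: (measurableT_comp (cc _ _)).
  exact: measurable_fst.
exact: measurable_snd.
Qed.

Lemma P1_of_pmf (S : set 'cV[R]_n) (q : 'cV[R]_n -> R) :
  finite_set S -> pmf S q ->
  exists mu : P1 R n, forall U, mu U = (\sum_(x \in S) q x * (x \in U)%:R)%:E.
Proof.
move=> finS [q0 qS q1]; pose s := finmap.enum_fset (fset_set S).
rewrite fsbig_finite // in q1.
have [P [PU Pf]] := atomic_probability (id : 'cV[R]_n -> Rn R n) q0 q1.
have h : (\int[P]_x (`|(x : 'cV[R]_n)|%R)%:E < +oo)%E.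
  by rewrite (Pf (fun x : 'cV[R]_n => `|x|)) ?ltry //; exact: measurable_norm_Rn.
by exists (MkP1 h) => U; rewrite /= PU fsbig_finite.
Qed.

(* The coupling leaves the common mass [m = min q q'] on the diagonal and couples
   the excesses [q - m] and [q' - m], of equal total mass [D], independently. *)
Lemma d1_le (S : set 'cV[R]_n) (q q' : 'cV[R]_n -> R) (mu nu : P1 R n) (c : R) :
  finite_set S -> pmf S q -> pmf S q' ->
  (forall U, mu U = (\sum_(x \in S) q x * (x \in U)%:R)%:E) ->
  (forall U, nu U = (\sum_(x \in S) q' x * (x \in U)%:R)%:E) ->
  (forall x y, S x -> S y -> `|x - y| <= c) ->
  (d1 mu nu <= (c * \sum_(x \in S) `|q x - q' x|)%:E)%E.
Proof.
move=> finS [q0 qS q1] [q'0 q'S q'1] muE nuE Sc.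
pose s := finmap.enum_fset (fset_set S).
have fsE (f : 'cV[R]_n -> R) : \sum_(x \in S) f x = \sum_(x <- s) f x by exact: fsbig_finite.
have sS x : x \in s -> S x by rewrite in_fset_set // => /set_mem.
have us : uniq s by exact: finmap.fset_uniq.
rewrite !fsE in q1 q'1 *.
pose m x := Num.min (q x) (q' x).
pose a x := q x - m x; pose b x := q' x - m x.
pose D := \sum_(x <- s) a x.
have a0 x : 0 <= a x by rewrite subr_ge0 ge_min lexx.
have b0 x : 0 <= b x by rewrite subr_ge0 ge_min lexx orbT.
have m0 x : 0 <= m x by rewrite le_min q0 q'0.
have D0 : 0 <= D by apply: sumr_ge0.
have bD : \sum_(x <- s) b x = D by rewrite /D !sumrB q1 q'1.
(* When [D = 0] the quotient [D / D] is 0 by convention, but then all the excesses vanish too. *)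
have aDD x : x \in s -> a x * (D / D) = a x.
  case: (eqVneq D 0) => [DE|D1]; last by rewrite divff ?mulr1.
  move=> xs; suff -> : a x = 0 by rewrite mul0r.
  by move/eqP: DE; rewrite psumr_eq0 // => /allP/(_ x xs)/eqP.
have bDD x : x \in s -> b x * (D / D) = b x.
  case: (eqVneq D 0) => [DE|D1]; last by rewrite divff ?mulr1.
  move=> xs; suff -> : b x = 0 by rewrite mul0r.
  by move/eqP: DE; rewrite -bD psumr_eq0 // => /allP/(_ x xs)/eqP.
pose w (z : 'cV[R]_n * 'cV[R]_n) := (z.1 == z.2)%:R * m z.1 + a z.1 * b z.2 / D.
have w0 z : 0 <= w z.
  by rewrite addr_ge0 ?mulr_ge0 ?invr_ge0.
have diag (f : 'cV[R]_n -> 'cV[R]_n -> R) x : x \in s ->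
    \sum_(y <- s) (x == y)%:R * f x y = f x x.
  move=> xs; rewrite (bigD1_seq x) //= eqxx mul1r big1 ?addr0 // => y.
  by rewrite eq_sym => /negPf->; rewrite mul0r.
have w1 x : x \in s -> \sum_(y <- s) w (x, y) = q x.
  move=> xs; rewrite /w big_split /= (diag (fun x _ => m x)) // -mulr_suml -mulr_sumr bD.
  by rewrite -mulrA aDD // /a addrC subrK.
have w2 y : y \in s -> \sum_(x <- s) w (x, y) = q' y.
  move=> ys; rewrite /w big_split /=; under eq_bigr do rewrite eq_sym.
  rewrite (diag (fun _ x => m x)) // -mulr_suml -mulr_suml -/D.
  by rewrite mulrAC mulrC bDD // /b addrC subrK.
pose ss := [seq (x, y) | x <- s, y <- s].
have ssE (f : 'cV[R]_n * 'cV[R]_n -> R) :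
    \sum_(z <- ss) f z = \sum_(x <- s) \sum_(y <- s) f (x, y) by rewrite big_allpairs.
have wT : \sum_(z <- ss) w z = 1.
  by rewrite ssE -q1; apply: eq_big_seq => x xs; rewrite w1.
have [P [PU Pf]] :=
  atomic_probability (id : 'cV[R]_n * 'cV[R]_n -> Rn R n * Rn R n) w0 wT.
apply: ge_ereal_inf; exists (\int[P]_z (`|(z.1 : 'cV[R]_n) - (z.2 : 'cV[R]_n)|%R)%:E)%E.
  exists P => //; split=> U _.
    rewrite PU muE fsE ssE; congr _%:E; apply: eq_big_seq => x xs.
    rewrite -w1 // mulr_suml; apply: eq_bigr => y _.
    by congr (_ * (nat_of_bool _)%:R); apply/asboolP/asboolP => [[]//|xU]; split.
  rewrite PU nuE fsE ssE exchange_big /=; congr _%:E; apply: eq_big_seq => x xs.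
  rewrite -w2 // mulr_suml; apply: eq_bigr => y _.
  by congr (_ * (nat_of_bool _)%:R); apply/asboolP/asboolP => [[]//|xU]; split.
rewrite (Pf (fun z : 'cV[R]_n * 'cV[R]_n => `|z.1 - z.2|)) //; last exact: measurable_dist_Rn.
rewrite lee_fin ssE.
have wd x : x \in s -> \sum_(y <- s) w (x, y) * `|x - y| <= c * `|q x - q' x|.
  move=> xs; apply: (@le_trans _ _ (\sum_(y <- s) c * (a x * b y / D))).
    (* The mass left on the diagonal is not moved and costs nothing. *)
    have -> : \sum_(y <- s) w (x, y) * `|x - y| = \sum_(y <- s) (a x * b y / D) * `|x - y|.
      under eq_bigr do rewrite /w mulrDl /= -mulrA.
      by rewrite big_split /= (diag (fun x y => m x * `|x - y|)) // subrr normr0 mulr0 add0r.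
    rewrite big_seq [leRHS]big_seq; apply: ler_sum => y ys; rewrite mulrC.
    by rewrite ler_wpM2r ?Sc ?mulr_ge0 ?invr_ge0 //; exact: sS.
  rewrite -mulr_sumr -mulr_suml -mulr_sumr bD -mulrA aDD //.
  have c0 : 0 <= c by apply: le_trans (Sc x x (sS _ xs) (sS _ xs)).
  rewrite ler_wpM2l // /a /m minElt; case: ifP => _; first by rewrite subrr.
  exact: ler_norm.
by rewrite mulr_sumr big_seq [leRHS]big_seq; apply: ler_sum => x; exact: wd.
Qed.
End Borel.

(** * Reachable states *)

Lemma compact_norm_bound (R : realType) (V : normedModType R) (A : set V) :
  compact A -> exists M : R, forall x, A x -> `|x| <= M.
Proof.
move=> /compact_bounded /pinfty_ex_gt0 [M _ hM]; exists M => x Ax; exact: hM.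
Qed.

Lemma has_sup_opnorm (R : realType) (m n : nat) (M : 'M[R]_(m, n)) :
  has_sup [set `|M *m v| | v in [set v : 'cV[R]_n | `|v| <= 1]].
Proof.
split; first by exists `|M *m (0 : 'cV_n)|, 0 => //=; rewrite normr0.
exists (\sum_i \sum_j `|M i j|) => _ [v /= v1 <-].
have v1' := elimT (mx_norm_leP v ler01) v1.
apply/mx_norm_leP => [|i j]; first by do 2 (apply: sumr_ge0 => ? _).
rewrite mxE (bigD1 i) //= -[leLHS]addr0 lerD //; last first.
  by do 2 (apply: sumr_ge0 => ? _).
apply: le_trans (ler_norm_sum _ _ _) _; apply: ler_sum => k _.
by rewrite normrM ler_piMr.
Qed.

Lemma opnormP (R : realType) (m n : nat) (M : 'M[R]_(m, n)) (v : 'cV[R]_n) :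
  `|M *m v| <= opnorm M * `|v|.
Proof.
have [->|v0] := eqVneq v 0; first by rewrite mulmx0 !normr0 mulr0.
have nv : 0 < `|v| by rewrite normr_gt0.
rewrite -ler_pdivrMr //; apply: (ub_le_sup (has_sup_opnorm M).2).
exists (`|v|^-1 *: v) => /=.
  by rewrite normrZ ger0_norm ?invr_ge0 // mulVf // gt_eqF.
by rewrite -scalemxAr normrZ ger0_norm ?invr_ge0 // mulrC.
Qed.

Lemma opnorm_ge0 (R : realType) (m n : nat) (M : 'M[R]_(m, n)) : 0 <= opnorm M.
Proof.
apply: le_trans (normr_ge0 (M *m (0 : 'cV[R]_n))) _.
by apply: (ub_le_sup (has_sup_opnorm M).2); exists 0 => //=; rewrite normr0.
Qed.

Section Blocks.
Context (R : realType) (m n : nat).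

Lemma norm_usubmx (x : 'cV[R]_(m + n)) : `|usubmx x| <= `|x|.
Proof.
apply/mx_norm_leP => // i j; rewrite mxE.
exact: (elimT (mx_norm_leP x (normr_ge0 x)) (lexx _)).
Qed.

Lemma norm_dsubmx (x : 'cV[R]_(m + n)) : `|dsubmx x| <= `|x|.
Proof.
apply/mx_norm_leP => // i j; rewrite mxE.
exact: (elimT (mx_norm_leP x (normr_ge0 x)) (lexx _)).
Qed.

Lemma norm_col_le (x : 'cV[R]_(m + n)) (e : R) :
  `|usubmx x| <= e -> `|dsubmx x| <= e -> `|x| <= e.
Proof.
move=> hu hd; have e0 : 0 <= e := le_trans (normr_ge0 _) hu.
apply/mx_norm_leP => // i j; case: (split_ordP i) => k ->.
  by have := elimT (mx_norm_leP _ e0) hu k j; rewrite mxE.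
by have := elimT (mx_norm_leP _ e0) hd k j; rewrite mxE.
Qed.
End Blocks.

Lemma finite_grid_ball (R : realType) (n Ns : nat) (c : 'cV[R]_n) (e : R) :
  (0 < Ns)%N -> finite_set [set x | @grid R n Ns x /\ `|x - c| <= e].
Proof.
move=> Ns0; pose h := dx R Ns.
have h0 : 0 < h by rewrite /h /dx invr_gt0 ltr0n.
(* Points of the ball have norm at most [e + |c|], so their integer coordinates lie between [-N] and
   [N]; a shift by [N] stores them as ordinals. *)
pose N := (Num.truncn ((e + `|c|) / h)).+1.
pose g (f : {ffun 'I_n -> 'I_(N + N).+1}) : 'cV[R]_n :=
  \col_i (((f i : nat)%:Z - N%:Z)%:~R * h).
apply: (@sub_finite_set _ _ [set g f | f in [set: {ffun 'I_n -> 'I_(N + N).+1}]]); last first.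
  by apply: finite_image; exact: finite_finset.
move=> x [xg xc].
have [z zP] := choice xg.
have zN i : `|z i| <= N%:Z.
  rewrite -(ler_int R) intr_norm.
  apply: le_trans (ltW (truncnS_gt _)); rewrite ler_pdivlMr //.
  rewrite -[h in leLHS](ger0_norm (ltW h0)) -normrM -zP.
  have xe : `|x| <= e + `|c| by rewrite -[x](subrK c) (le_trans (ler_normD _ _)) // lerD2r.
  have e0 : 0 <= e + `|c| := le_trans (normr_ge0 _) xe.
  exact: (elimT (mx_norm_leP x e0) xe).
have zb i : (absz (z i + N%:Z)%R < (N + N).+1)%N.
  by have := zN i; rewrite ler_norml => /andP[]; lia.
exists [ffun i => Ordinal (zb i)] => //.
apply/colP => i; rewrite mxE ffunE /= zP; congr (_%:~R * _).
by have := zN i; rewrite ler_norml => /andP[]; lia.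
Qed.

Section Scheme.
Context (R : realType) (r s : nat) (T : R) (D : mfg_data R (r + s) r).
Context (LA CB Chat CI cK : R) (beta : 'cV[R]_s -> 'cV[R]_s -> R).
Context (m0 : probability (Rn R (r + s)) R) (K : set 'cV[R]_(r + s)).
Context (Nt Ns : nat).
Hypotheses (T0 : 0 < T) (hdyn : dynamics_admissible T D (@lshift r s) LA CB).
Hypotheses (Chat0 : 0 < Chat) (CI0 : 0 < CI) (hbeta : Q1_basis Ns CI beta).
Hypotheses (hm0 : compact (msupp m0)) (hK : compact K).
Hypothesis hKsub : forall k, (k <= Nt)%N ->
  Kset m0 (drift_cst T D LA) CB Chat CI (dt T Nt) (dx R Ns) k `<=` K.
Hypothesis cK0 : 0 < cK.
Hypothesis hB1 : forall (t : R) x, 0 <= t <= T -> K x -> opnorm (invmx (B1 D t x)) <= cK.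
Hypotheses (Nt0 : (0 < Nt)%N) (Ns0 : (0 < Ns)%N).
Hypothesis hratio : dx R Ns / dt T Nt <= Num.min 1 (Chat / cK).

Local Notation E := 'cV[R]_(r + s).
Local Notation Dt := (dt T Nt).
Local Notation t_ k := (tgrid T Nt k).
Local Notation CA := (drift_cst T D LA).
Local Notation Kset := (Kset m0 CA CB Chat CI Dt (dx R Ns)).
Local Notation S1 := (S1 T D Chat Nt Ns).
Local Notation S2 := (S2 T D beta Nt Ns).
Local Notation Sx := (Sx T D Chat beta Nt Ns).
Local Notation Sk := (Sk T D Chat beta m0 Nt Ns).

Lemma Dt_gt0 : 0 < Dt. Proof. by rewrite divr_gt0 // ltr0n. Qed.

Lemma dx_gt0 : 0 < dx R Ns. Proof. by rewrite /dx invr_gt0 ltr0n. Qed.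

Lemma tgrid_itv k : (k <= Nt)%N -> 0 <= t_ k <= T.
Proof.
move=> kN; rewrite /tgrid /dt; apply/andP; split.
  by rewrite mulr_ge0 // divr_ge0 // ltW.
by rewrite mulrA ler_pdivrMr ?ltr0n // mulrC ler_wpM2l ?ler_nat // ltW.
Qed.

Lemma B1_unit t x : 0 <= t <= T -> B1 D t x \in unitmx.
Proof.
move=> tT; have [_ _ _ _ [_ _ _ /(_ t x tT)]] := hdyn.
rewrite -row_free_unit; congr (is_true (row_free _)).
by apply/matrixP => i j; rewrite !mxE.
Qed.

(** The supremum in [drift_cst] is a true upper bound because the drift is continuous on the compact
    set of pairs [(t, 0)]; the Lipschitz constant accounts for the growth in [x]. *)
Lemma norm_drift_le t x : 0 <= t <= T -> `|drift D t x| <= CA * (1 + `|x|).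
Proof.
move=> tT; have [cA _ [LA0 hA] _ _] := hdyn.
have [M hM] : exists M : R, forall u, 0 <= u <= T -> `|drift D u 0| <= M.
  pose A := [set z : R * E | 0 <= z.1 <= T /\ z.2 = 0].
  have cptA : compact A.
    have -> : A = `[0, T]%classic `*` [set 0].
      by apply/seteqP; split=> [[u x0] /= []|[u x0] /= []]; rewrite /A /= in_itv.
    by apply: compact_setX; [exact: segment_compact|exact: compact_set1].
  have AI : A `<=` [set z : R * E | [set t | 0 <= t <= T] z.1] by move=> z [].
  have [M hM] := compact_norm_bound (continuous_compact (continuous_subspaceW AI cA) cptA).
  by exists M => u uT; apply: hM; exists (u, 0).
have h0 : `|drift D t 0| <= CA.
  rewrite /drift_cst le_max; apply/orP; left; apply: ub_le_sup; last by exists t.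
  by exists M => _ [u uT <-]; exact: hM.
rewrite mulrDr mulr1 -[drift D t x](subrK (drift D t 0)) addrC.
apply: le_trans (ler_normD _ _) _; apply: lerD => //.
apply: le_trans (hA _ _ _ tT) _; rewrite subr0 ler_wpM2r // /drift_cst.
by rewrite le_max lexx orbT.
Qed.

Lemma norm_ctrl_le t x (v : 'cV[R]_r) : 0 <= t <= T -> `|ctrl D t x *m v| <= CB * `|v|.
Proof.
move=> tT; have [_ _ _ _ [_ /(_ t x tT) hB _ _]] := hdyn.
by apply: le_trans (opnormP _ _) _; rewrite ler_wpM2r.
Qed.

(** The Euler step with control [ctrl_to] moves the first block exactly onto [y1], so a bound on
    controls becomes a bound on displacements. *)
Lemma ctrl_toK k x y1 : (k <= Nt)%N ->
  y1 - usubmx x = Dt *: (usubmx (drift D (t_ k) x) + B1 D (t_ k) x *m ctrl_to T D Nt k x y1).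
Proof.
move=> kN; rewrite /ctrl_to mulKVmx ?B1_unit ?tgrid_itv // [in RHS]addrC subrK.
by rewrite scalerA mulfV ?scale1r // gt_eqF // Dt_gt0.
Qed.

Lemma finite_S1 k x : (k <= Nt)%N -> finite_set (S1 k x).
Proof.
move=> kN.
pose e := Dt * (`|usubmx (drift D (t_ k) x)| + opnorm (B1 D (t_ k) x) * Chat).
apply: sub_finite_set (finite_grid_ball (usubmx x) e Ns0) => y1 [yg yC]; split=> //.
rewrite (ctrl_toK _ _ kN) normrZ gtr0_norm ?Dt_gt0 // ler_wpM2l ?(ltW Dt_gt0) //.
apply: le_trans (ler_normD _ _) _; rewrite lerD2l.
by apply: le_trans (opnormP _ _) _; rewrite ler_wpM2l // opnorm_ge0.
Qed.

Lemma S2_near k x y1 z : S2 k x y1 z -> `|y2_end T D Nt k x y1 - z| <= CI * dx R Ns.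
Proof. by move=> [zg zs]; have [_ _ _ _ /(_ z zg)] := hbeta; apply. Qed.

Lemma finite_S2 k x y1 : finite_set (S2 k x y1).
Proof.
apply: sub_finite_set (finite_grid_ball (y2_end T D Nt k x y1) (CI * dx R Ns) Ns0) => z zS.
by split; [case: zS|rewrite distrC; exact: S2_near].
Qed.

Lemma sum_beta_S2 k x y1 : \sum_(z \in S2 k x y1) beta z (y2_end T D Nt k x y1) = 1.
Proof.
have [_ _ _ /(_ (y2_end T D Nt k x y1)) <- _] := hbeta; apply: fsbig_widen => [z []//|z [zg zS]] /=.
apply/eqP/negPn/negP => bz; apply: zS; split=> //.
exact: subset_closure.
Qed.

(** An Euler step with control at most [Chat] gives the first term. The first block lands exactly on
    the grid; only the second one is spread over neighbouring vertices, at distance at most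
    [CI * dx]. *)
Lemma Sx_near k x y : (k < Nt)%N -> Sx k x y ->
  `|y - x| <= Dt * (CA * (1 + `|x|) + CB * Chat) + CI * dx R Ns.
Proof.
move=> kN [S1y S2y]; set a := ctrl_to T D Nt k x (usubmx y).
have kT := tgrid_itv (ltnW kN).
have CB0 : 0 < CB by have [_ _ _ _ []] := hdyn.
pose v := Dt *: (drift D (t_ k) x + ctrl D (t_ k) x *m a).
have hv : `|v| <= Dt * (CA * (1 + `|x|) + CB * Chat).
  rewrite normrZ gtr0_norm ?Dt_gt0 // ler_wpM2l ?(ltW Dt_gt0) //.
  apply: le_trans (ler_normD _ _) _; apply: lerD; first exact: norm_drift_le.
  apply: le_trans (norm_ctrl_le _ _ kT) _.
  by rewrite (ler_wpM2l (ltW CB0)) //; case: S1y.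
have CI' : 0 <= CI * dx R Ns by rewrite mulr_ge0 ?ltW ?dx_gt0.
apply: norm_col_le.
  rewrite raddfB /= (ctrl_toK _ _ (ltnW kN)) -/a.
  have -> : Dt *: (usubmx (drift D (t_ k) x) + B1 D (t_ k) x *m a) = usubmx v.
    by rewrite /v /B1 mul_usub_mx [RHS]linearZ /= [usubmx (_ + _)]linearD.
  by apply: le_trans (norm_usubmx _) _; apply: le_trans hv _; rewrite lerDl.
rewrite raddfB /=; have h2 := S2_near S2y.
have -> : dsubmx y - dsubmx x = dsubmx v - (y2_end T D Nt k x (usubmx y) - dsubmx y).
  rewrite /y2_end /B2 -/a mul_dsub_mx /v [dsubmx (_ *: _)]linearZ /= [dsubmx (_ + _)]linearD.
  by rewrite opprB [RHS]addrC opprD [in RHS]addrA subrK.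
apply: le_trans (ler_normB _ _) _; apply: lerD => //.
exact: le_trans (norm_dsubmx _) hv.
Qed.

Lemma Sk_sub_Kset k : (k <= Nt)%N -> Sk k `<=` Kset k.
Proof.
elim: k => [_ x []//|k IHk kN y [x xS xy]] /=.
have xK := IHk (ltnW kN) x xS.
have [M hM] := compact_norm_bound hK.
have LA0 : 0 < LA by have [_ _ []] := hdyn.
have CB0 : 0 < CB by have [_ _ _ _ []] := hdyn.
have CA0 : 0 <= CA by rewrite /drift_cst le_max (ltW LA0) orbT.
(* The supremum is effective because [Kset k] lies in the compact set [K]. *)
have xsup : `|x| <= sup [set `|x| | x in Kset k].
  apply: ub_le_sup; last by exists x.
  by exists M => _ [z zK <-]; apply/hM/(hKsub (ltnW kN)).
pose rho := Dt * (CA * (1 + sup [set `|x| | x in Kset k]) + CB * Chat) + CI * dx R Ns.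
have hr : `|y - x| <= rho.
  apply: le_trans (Sx_near kN xy) _; rewrite lerD2r ler_wpM2l ?(ltW Dt_gt0) //.
  by rewrite lerD2r ler_wpM2l // lerD2l.
have r0 : 0 < rho.
  apply: ltr_wpDl; last by rewrite mulr_gt0 ?dx_gt0.
  apply: mulr_ge0; first exact/ltW/Dt_gt0.
  apply: addr_ge0; last by rewrite mulr_ge0 ?ltW.
  by rewrite mulr_ge0 // addr_ge0 // (le_trans _ xsup).
exists x => //; exists (rho^-1 *: (y - x)) => /=.
  by rewrite normrZ gtr0_norm ?invr_gt0 // ler_pdivrMl // mulr1.
by rewrite scalerA mulfV ?gt_eqF // scale1r addrC subrK.
Qed.

Lemma Sk_sub k : (k <= Nt)%N -> Sk k `<=` K.
Proof. by move=> kN x /(Sk_sub_Kset kN)/(hKsub kN). Qed.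

Lemma finite_Sx k x : (k <= Nt)%N -> finite_set (Sx k x).
Proof.
move=> kN; apply: (@sub_finite_set _ _
  (\bigcup_(y1 in S1 k x) [set col_mx y1 z | z in S2 k x y1])).
  by move=> y [y1 y2]; exists (usubmx y) => //; exists (dsubmx y); rewrite ?vsubmxK.
apply: bigcup_finite => [|y1 _]; first exact: finite_S1.
by apply: finite_image; exact: finite_S2.
Qed.

Lemma finite_Sk k : (k <= Nt)%N -> finite_set (Sk k).
Proof.
elim: k => [_|k IHk kN] /=; last first.
  apply: bigcup_finite => [|x _]; first exact: IHk (ltnW kN).
  exact: finite_Sx (ltnW kN).
have [M hM] := compact_norm_bound hm0.
apply: sub_finite_set (finite_grid_ball 0 M Ns0) => x [[xu xd] xm]; split.
  by move=> i; case: (split_ordP i) => j ->; [have := xu j|have := xd j]; rewrite mxE.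
by rewrite subr0; exact: hM.
Qed.

(* Rounding the uncontrolled endpoint [x1 + Dt A1] to the grid costs a control of
   size at most [cK dx / Dt]. *)
Lemma S1_neq0 k x : (k < Nt)%N -> Sk k x -> S1 k x !=set0.
Proof.
move=> kN xS; have kT := tgrid_itv (ltnW kN); have h0 := dx_gt0; have Dt0 := Dt_gt0.
pose c := usubmx x + Dt *: usubmx (drift D (t_ k) x).
pose y1 : 'cV[R]_r := \col_i ((Num.floor (c i 0 / dx R Ns))%:~R * dx R Ns).
exists y1; split; first by move=> i; exists (Num.floor (c i 0 / dx R Ns)); rewrite mxE.
have hy : `|y1 - c| <= dx R Ns.
  apply/mx_norm_leP => [|i j]; first exact: ltW.
  rewrite ord1 !mxE; have /andP[] := floor_itv (c i 0 / dx R Ns).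
  rewrite ler_pdivlMr // ltr_pdivrMr // rmorphD /= mulrDl mul1r.
  by rewrite ler_norml /c !mxE; move=> *; apply/andP; split; lra.
have -> : ctrl_to T D Nt k x y1 = invmx (B1 D (t_ k) x) *m (Dt^-1 *: (y1 - c)).
  rewrite /ctrl_to; congr (_ *m _); rewrite /c opprD addrA [in RHS]scalerBr scalerA.
  by rewrite mulVf ?scale1r // gt_eqF.
apply: le_trans (opnormP _ _) _.
apply: (@le_trans _ _ (cK * (dx R Ns / Dt))); last first.
  by rewrite mulrC -ler_pdivlMr //; apply: le_trans hratio _; rewrite ge_min lexx orbT.
apply: ler_pM => //; first exact: opnorm_ge0.
  by apply: hB1 => //; apply: (Sk_sub (ltnW kN)).
by rewrite normrZ gtr0_norm ?invr_gt0 // mulrC ler_wpM2r // invr_ge0 ltW.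
Qed.
End Scheme.

(** * The best response *)

Section Response.
Context (R : realType) (r s : nat) (T : R) (D : mfg_data R (r + s) r).
Context (Chat eps : R) (beta : 'cV[R]_s -> 'cV[R]_s -> R).
Context (m0 : probability (Rn R (r + s)) R) (Nt Ns : nat).

Local Notation E := 'cV[R]_(r + s).
Local Notation Dt := (dt T Nt).
Local Notation t_ k := (tgrid T Nt k).
Local Notation S1 := (S1 T D Chat Nt Ns).
Local Notation S2 := (S2 T D beta Nt Ns).
Local Notation Sx := (Sx T D Chat beta Nt Ns).
Local Notation Sk := (Sk T D Chat beta m0 Nt Ns).
Local Notation ctrl_to := (ctrl_to T D Nt).
Local Notation y2_end := (y2_end T D Nt).
Local Notation value := (value T D Chat beta eps Nt Ns).
Local Notation popt := (popt T D Chat beta eps Nt Ns).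
Local Notation Ptrans := (Ptrans T D Chat beta eps Nt Ns).
Local Notation br := (br T D Chat beta m0 eps Nt Ns).

Hypotheses (eps0 : 0 < eps) (finSk : forall k, (k <= Nt)%N -> finite_set (Sk k)).
Hypothesis finS1 : forall k x, (k <= Nt)%N -> finite_set (S1 k x).
Hypothesis finS2 : forall k x y1, finite_set (S2 k x y1).
Hypothesis S1_neq0 : forall k x, (k < Nt)%N -> Sk k x -> S1 k x !=set0.
Hypothesis beta_ge0 : forall z y, grid Ns z -> 0 <= beta z y.
Hypothesis sum_beta : forall k x y1, \sum_(z \in S2 k x y1) beta z (y2_end k x y1) = 1.
Hypothesis hinit : initial_mass_one m0 Ns.

(** Isolated so that [objective] unfolds to the [free_energy] of this cost, to which the Gibbs
    formulas apply. *)
Definition stage_cost (M : nat -> P1 R (r + s)) (k : nat) (x : E) (y1 : 'cV[R]_r) : R :=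
  Dt * ell D (t_ k) (ctrl_to k x y1) x (M k) +
  interp beta (S2 k x y1) (fun z => value M k.+1 (col_mx y1 z)) (y2_end k x y1).

Lemma poptE M k x : (k < Nt)%N -> Sk k x ->
  popt M k x = gibbs (S1 k x) eps (stage_cost M k x).
Proof.
move=> kN xS; have fS1 := finS1 x (ltnW kN); have nS1 := S1_neq0 kN xS.
rewrite /popt; set P := [set _ | _].
have [|qP qmin] := @xgetPex _ (fun=> 0) P.
  exists (gibbs (S1 k x) eps (stage_cost M k x)); split; first exact: gibbs_pmf.
  move=> q' q'P.
  change (free_energy (S1 k x) eps (stage_cost M k x) (gibbs (S1 k x) eps (stage_cost M k x))
    <= free_energy (S1 k x) eps (stage_cost M k x) q').
  rewrite (free_energy_gibbs _ fS1 nS1 eps0).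
  by have [] := gibbs_variational (stage_cost M k x) fS1 nS1 eps0 q'P.
exact: (argmin_free_energy fS1 nS1 eps0).
Qed.

Lemma valueE M k x : (k < Nt)%N -> Sk k x ->
  value M k x = - eps * ln (partition_fun (S1 k x) eps (stage_cost M k x)).
Proof.
move=> kN xS; rewrite /Defs.value -subnSK //= subnSK // subKn ?(ltnW kN) //.
exact: (inf_free_energy _ (finS1 x (ltnW kN)) (S1_neq0 kN xS) eps0).
Qed.

Lemma col_Sk k x y1 z : Sk k x -> S1 k x y1 -> S2 k x y1 z -> Sk k.+1 (col_mx y1 z).
Proof. by move=> xS y1S zS; exists x => //; rewrite /Defs.Sx /= col_mxKu col_mxKd. Qed.

Lemma Ptrans_ge0 M k x y : (k < Nt)%N -> Sk k x -> 0 <= Ptrans M k x y.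
Proof.
move=> kN xS; rewrite /Defs.Ptrans; case: asboolP => // -[_ [zg _]].
rewrite poptE // mulr_ge0 ?beta_ge0 //.
by have [] := gibbs_pmf eps (stage_cost M k x) (finS1 x (ltnW kN)) (S1_neq0 kN xS).
Qed.

Lemma sum_Ptrans M k x : (k < Nt)%N -> Sk k x -> \sum_(y \in Sk k.+1) Ptrans M k x y = 1.
Proof.
move=> kN xS; have fS1 := finS1 x (ltnW kN).
have P0 y : ~ Sx k x y -> Ptrans M k x y = 0.
  by rewrite /Defs.Ptrans; case: asboolP.
(* The fibre [S2 k x y1] varies with [y1]; enlarging all fibres to their union [Z] turns the index
   set into a product, over which the sum can be iterated. *)
pose Z := \bigcup_(y1 in S1 k x) S2 k x y1.
have finZ : finite_set Z by apply: bigcup_finite => // y1 _; exact: finS2.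
pose Q := [set y : E | S1 k x (usubmx y) /\ Z (dsubmx y)].
have SxQ : Sx k x `<=` Q by move=> y [y1S y2S]; split=> //; exists (usubmx y).
transitivity (\sum_(y \in Q) Ptrans M k x y).
  transitivity (\sum_(y \in Sx k x) Ptrans M k x y).
    by apply/esym/fsbig_widen => [y ySx|y [_ /P0]//]; exists x.
  by apply/fsbig_widen => [//|y [_ /P0]].
transitivity (\sum_(u \in S1 k x `*` Z) Ptrans M k x (col_mx u.1 u.2)).
  apply: reindex_fsbig; split.
  - by move=> [y1 z] [/= h1 h2]; rewrite /Q /= col_mxKu col_mxKd.
  - by move=> [y1 z] [y1' z'] _ _ /= /eq_col_mx [-> ->].
  - by move=> y [h1 h2]; exists (usubmx y, dsubmx y) => //=; rewrite vsubmxK.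
rewrite -(pair_fsbig _ (fun y1 z => Ptrans M k x (col_mx y1 z))) //.
have [_ _ <-] := gibbs_pmf eps (stage_cost M k x) fS1 (S1_neq0 kN xS).
apply: eq_fsbigr => y1 /set_mem y1S.
transitivity (\sum_(z \in S2 k x y1) Ptrans M k x (col_mx y1 z)).
  apply/esym/fsbig_widen => [z zS|z [_ zS]] /=; first by exists y1.
  by apply: P0 => -[_]; rewrite col_mxKu col_mxKd.
rewrite -[RHS]mulr1 -(sum_beta k x y1) !fsbig_finite // mulr_sumr.
apply: eq_big_seq => z; rewrite in_fset_set // => /set_mem zS.
rewrite /Defs.Ptrans asboolT; last by rewrite /Defs.Sx /= col_mxKu col_mxKd.
by rewrite poptE // col_mxKu col_mxKd.
Qed.

Lemma br_pmf M k : (k <= Nt)%N ->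
  (forall y, Sk k y -> 0 <= br M k y) /\ \sum_(y \in Sk k) br M k y = 1.
Proof.
elim: k => [_|k IHk kN].
  by split=> [y _|]; [exact: fine_ge0|exact: hinit].
have [b0 b1] := IHk (ltnW kN); have fS := finSk (ltnW kN); split=> [y _|] /=.
  rewrite fsbig_finite // big_seq; apply: sumr_ge0 => x; rewrite in_fset_set // => /set_mem xS.
  by rewrite mulr_ge0 ?Ptrans_ge0 // b0.
rewrite exchange_fsbig //; last exact: (finSk kN).
rewrite -b1; apply: eq_fsbigr => x /set_mem xS.
rewrite -[RHS]mul1r -(sum_Ptrans M kN xS) !fsbig_finite //; try exact: (finSk kN).
by rewrite mulr_suml.
Qed.

Lemma Sk_neq0 k : (k <= Nt)%N -> Sk k !=set0.
Proof.
elim: k => [_|k IHk kN].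
  apply/set0P/eqP => S00; have := hinit; rewrite /initial_mass_one -/(Sk 0) S00.
  by rewrite fsbig_set0 => /eqP; rewrite eq_sym oner_eq0.
have [x xS] := IHk (ltnW kN); have [y1 y1S] := S1_neq0 kN xS.
have [z zS] : S2 k x y1 !=set0.
  apply/set0P/eqP => S20; have := sum_beta k x y1; rewrite S20.
  by rewrite fsbig_set0 => /eqP; rewrite eq_sym oner_eq0.
by exists (col_mx y1 z); exact: col_Sk zS.
Qed.

(** * Continuity of the best response in the masses *)

Section Continuity.
Context (U : topologicalType) (mu : U -> nat -> E -> R) (M : U -> nat -> P1 R (r + s)).
Hypothesis muP : forall u k, (k <= Nt)%N -> pmf (Sk k) (mu u k).
Hypothesis cmu : forall k x, (k <= Nt)%N -> continuous (fun u => mu u k x).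
Hypothesis MP : forall u k, (k <= Nt)%N ->
  forall V, M u k V = (\sum_(x \in Sk k) mu u k x * (x \in V)%:R)%:E.
Hypothesis c_ell : ell_continuous T D.
Hypothesis c_gfin : gfin_continuous D.
Hypothesis t_itv : forall k, (k <= Nt)%N -> 0 <= t_ k <= T.

Lemma near_d1 k u e : (k <= Nt)%N -> 0 < e ->
  \forall v \near u, (d1 (M u k) (M v k) < e%:E)%E.
Proof.
move=> kN e0; have fS := finSk kN.
have [B hB] : exists B : R, forall x, Sk k x -> `|x| <= B.
  exists (\sum_(x \in Sk k) `|x|) => x xS; rewrite fsbig_finite //.
  by rewrite (bigD1_seq x) ?finmap.fset_uniq ?in_fset_set ?mem_set //= lerDl sumr_ge0.
(* [B + B] bounds the diameter of [Sk k]; the maximum with 1 makes [c] positive, so that [e / c] is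
   a valid threshold. *)
pose c := Num.max (B + B) 1.
have c0 : 0 < c by rewrite lt_max ltr01 orbT.
have hc x y : Sk k x -> Sk k y -> `|x - y| <= c.
  move=> xS yS; apply: le_trans (ler_normB _ _) _.
  by rewrite le_max lerD // hB.
have cs : continuous (fun v => \sum_(x \in Sk k) `|mu u k x - mu v k x| : R).
  apply: continuous_fsbig => // x _ v; apply: cvg_norm.
  exact: (cvgB (cvg_cst (mu u k x)) (@cmu k x kN v)).
have : \forall v \near u, \sum_(x \in Sk k) `|mu u k x - mu v k x| < e / c.
  have := cs u; rewrite /continuous_at => /cvgr_lt; apply.
  rewrite (eq_fsbigr (fun=> 0)) => [|x _]; last by rewrite subrr normr0.
  by rewrite fsbig_finite // big1 // divr_gt0.
apply: filterS => v hv.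
apply: le_lt_trans (d1_le fS (muP u kN) (muP v kN) (MP u kN) (MP v kN) hc) _.
by rewrite lte_fin -ltr_pdivlMl // mulrC.
Qed.

Lemma continuous_ell k a x : (k <= Nt)%N -> continuous (fun u => ell D (t_ k) a x (M u k)).
Proof.
move=> kN u; apply/cvgrPdist_lt => /= e e0.
have [delta d0 hd] := c_ell a x (M u k) (t_itv kN) e0.
near=> v; apply: hd; rewrite ?subrr ?normr0 //; first exact: t_itv.
by near: v; exact: near_d1.
Unshelve. all: by end_near.
Qed.

Lemma continuous_gfin x : continuous (fun u => gfin D x (M u Nt)).
Proof.
move=> u; apply/cvgrPdist_lt => /= e e0.
have [delta d0 hd] := c_gfin x (M u Nt) e0.
near=> v; apply: hd; rewrite ?subrr ?normr0 //.
by near: v; exact: near_d1.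
Unshelve. all: by end_near.
Qed.

Lemma continuous_stage_cost k x y1 : (k < Nt)%N ->
  (forall z, S2 k x y1 z -> continuous (fun u => value (M u) k.+1 (col_mx y1 z))) ->
  continuous (fun u => stage_cost (M u) k x y1).
Proof.
move=> kN cV; have ci : continuous (fun u => interp beta (S2 k x y1)
    (fun z => value (M u) k.+1 (col_mx y1 z)) (y2_end k x y1)).
  apply: continuous_fsbig => // z zS u.
  exact: (cvgM (cvg_cst _) (@cV z zS u)).
move=> u; have ce := @continuous_ell k (ctrl_to k x y1) x (ltnW kN) u.
exact: (cvgD (cvgM (cvg_cst _) ce) (ci u)).
Qed.

Lemma continuous_boltzmann k x y1 : continuous (fun u => stage_cost (M u) k x y1) ->
  continuous (fun u => expR (- (stage_cost (M u) k x y1 / eps))).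
Proof.
move=> cc u; have h := cvgN (cvgM (cc u) (cvg_cst eps^-1)).
apply: (@continuous_comp _ _ _ (fun v => - (stage_cost (M v) k x y1 / eps)) (@expR R)).
  exact: h.
exact: continuous_expR.
Qed.

Lemma continuous_partition k x : (k < Nt)%N ->
  (forall y1, S1 k x y1 -> continuous (fun u => stage_cost (M u) k x y1)) ->
  continuous (fun u => partition_fun (S1 k x) eps (stage_cost (M u) k x)).
Proof.
move=> kN cc; apply: continuous_fsbig => [|y1 y1S]; first exact: finS1 (ltnW kN).
by apply: continuous_boltzmann; exact: cc.
Qed.

(** Backward induction from the final time, [i] counting the steps that remain; the logarithm is
    continuous at the positive partition function. *)
Lemma continuous_value k x : (k <= Nt)%N -> Sk k x -> continuous (fun u => value (M u) k x).
Proof.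
move=> kN; rewrite -(subKn kN); elim: (Nt - k)%N x (leq_subr k Nt) => [|i IHi] x iN.
  by rewrite subn0 => xS; rewrite /Defs.value subnn; exact: continuous_gfin.
have lt : (Nt - i.+1 < Nt)%N by rewrite ltn_subrL /= (leq_trans _ iN).
move=> xS; under eq_fun do rewrite valueE //.
have cP : continuous (fun u =>
    partition_fun (S1 (Nt - i.+1) x) eps (stage_cost (M u) (Nt - i.+1) x)).
  apply: continuous_partition => // y1 y1S; apply: continuous_stage_cost => // z zS.
  have := col_Sk xS y1S zS; rewrite subnSK // => cS; apply: IHi => //; exact: ltnW.
move=> u; apply: (cvgM (cvg_cst _)).
apply: (@continuous_comp _ _ _ _ (@ln R)); first exact: cP.
apply: continuous_ln.
exact: (partition_fun_gt0 _ _ (finS1 x (ltnW lt)) (S1_neq0 lt xS)).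
Qed.

Lemma continuous_cost k x y1 : (k < Nt)%N -> Sk k x -> S1 k x y1 ->
  continuous (fun u => stage_cost (M u) k x y1).
Proof.
move=> kN xS y1S; apply: continuous_stage_cost => // z zS.
by apply: continuous_value => //; exact: col_Sk zS.
Qed.

(** The minimizer is defined by a choice, so its continuity is read off the explicit Gibbs
    formula. *)
Lemma continuous_Ptrans k x y : (k < Nt)%N -> Sk k x -> continuous (fun u => Ptrans (M u) k x y).
Proof.
move=> kN xS; rewrite /Defs.Ptrans; case: asboolP => [[y1S _]|_]; last by move=> u; exact: cvg_cst.
under eq_fun do rewrite poptE // /gibbs mem_set //.
have cP := continuous_partition kN (fun y1 => @continuous_cost k x y1 kN xS).
have cb := continuous_boltzmann (continuous_cost kN xS y1S).
move=> u; apply: (cvgM _ (cvg_cst _)).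
apply: (cvgM (cb u)); apply: cvgV (cP u).
by rewrite gt_eqF //; exact: (partition_fun_gt0 _ _ (finS1 x (ltnW kN)) (S1_neq0 kN xS)).
Qed.

Lemma continuous_br k y : (k <= Nt)%N -> continuous (fun u => br (M u) k y).
Proof.
elim: k y => [|k IHk] y kN; first by move=> u; exact: cvg_cst.
apply: continuous_fsbig => [|x xS u]; first exact: finSk (ltnW kN).
exact: (cvgM (@continuous_Ptrans k x y kN xS u) (IHk x (ltnW kN) u)).
Qed.
End Continuity.

Lemma exists_fixpoint_br :
  ell_continuous T D -> gfin_continuous D ->
  (forall k, (k <= Nt)%N -> 0 <= t_ k <= T) ->
  exists M, mfg_solution T D Chat beta m0 eps Nt Ns M.
Proof.
move=> c_ell c_gfin t_itv.
have pmf0 : pmf [set (0 : E)] (fun x => (x == 0)%:R : R).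
  split=> [y|y|]; rewrite ?ler0n ?fsbig_set1 ?eqxx //.
  by move=> /= /eqP/negPf->.
(* The Dirac mass at 0 is the default measure when the prescribed masses do not form a probability
   mass function. *)
have [mu0 _] := P1_of_pmf (finite_set1 (0 : E)) pmf0.
have ex (z : nat * (E -> R)) : exists mu : P1 R (r + s), (z.1 <= Nt)%N -> pmf (Sk z.1) z.2 ->
    forall U, mu U = (\sum_(x \in Sk z.1) z.2 x * (x \in U)%:R)%:E.
  case: z => k q /=; case: (leqP k Nt) => [kN|_]; last by exists mu0.
  case: (pselect (pmf (Sk k) q)) => [qP|nq]; last by exists mu0.
  by have [mu hmu] := P1_of_pmf (finSk kN) qP; exists mu.
(* The fixed point is sought among masses; [meas] turns masses on [Sk k] into a measure carried by
   that set. *)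
have [meas measP] := choice ex.
pose Mof (mu : nat -> E -> R) k := meas (k, mu k).
have MofP mu : (forall k, (k <= Nt)%N -> pmf (Sk k) (mu k)) -> forall k, (k <= Nt)%N ->
    forall V, Mof mu k V = (\sum_(x \in Sk k) mu k x * (x \in V)%:R)%:E.
  by move=> muP k kN; exact: (measP (k, mu k) kN (muP k kN)).
have [||mu muP muE] := @fixpoint_pmf R E Nt Sk (fun mu => br (Mof mu)) finSk Sk_neq0.
- by move=> mu muP k kN; exact: br_pmf.
- move=> U mu muP cmu k x kN xS.
  refine (@continuous_br U mu (fun u => Mof (mu u)) muP cmu _ c_ell c_gfin t_itv k x kN).
  by move=> u; exact: (MofP (mu u) (muP u)).
exists (Mof mu); split=> k kN.
  have [_ _ q1] := muP k kN.
  rewrite MofP //; congr _%:E; rewrite -[RHS]q1; apply: eq_fsbigr => x xS.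
  by rewrite xS mulr1.
move=> y yS; rewrite muE // /mass MofP //= (_ : \sum_(x \in Sk k) _ = \sum_(x \in [set y]) mu k x).
  by rewrite fsbig_set1.
transitivity (\sum_(x \in [set y]) mu k x * (x \in [set y])%:R).
  apply/esym/fsbig_widen => [_ ->//|x [_ xy]] /=.
  by rewrite memNset // mulr0.
by apply: eq_fsbigr => x ->; rewrite mulr1.
Qed.
End Response.

Theorem proposition4p1 (R : realType) (r s : nat) (hr : (0 < r)%N)
    (T p : R) (hT : 0 < T) (hp : 1 < p)
    (D : mfg_data R (r + s) r) (LA CB : R)
    (hD : admissible_data T p D (@lshift r s) LA CB)
    (Chat : R) (hChat : control_bound T D Chat)
    (CI : R) (hCI : 0 < CI)
    (beta : nat -> 'cV[R]_s -> 'cV[R]_s -> R)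
    (hbeta : forall Ns, (0 < Ns)%N -> Q1_basis Ns CI (beta Ns))
    (m0 : probability (Rn R (r + s)) R) (hm0 : compact (msupp m0))
    (K : set 'cV[R]_(r + s)) (hK : compact K)
    (hKsub : forall Nt Ns, (0 < Nt)%N -> (0 < Ns)%N -> dx R Ns <= dt T Nt ->
       forall k, (k <= Nt)%N ->
         Kset m0 (drift_cst T D LA) CB Chat CI (dt T Nt) (dx R Ns) k `<=` K)
    (cK : R) (hcK : 0 < cK)
    (hB1 : forall (t : R) x, 0 <= t <= T -> K x -> opnorm (invmx (B1 D t x)) <= cK)
    (Nt Ns : nat) (hN : admissible_params T Chat m0 Nt Ns cK)
    (eps : R) (heps : 0 < eps)
    (hinit : initial_mass_one m0 Ns) :
  exists M : nat -> P1 R (r + s),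
    mfg_solution T D Chat (beta Ns) m0 eps Nt Ns M.
Proof.
have [Nt0 Ns0 hratio _] := hN; have [Chat0 _] := hChat.
have [[c_ell _ _ _ _] [c_gfin _ _] hdyn] := hD.
have hb := hbeta Ns Ns0.
(* The first entry of the minimum in the ratio condition gives [dx <= dt], under which [K] contains
   all the state sets; the second entry is used by [S1_neq0]. *)
have dxdt : dx R Ns <= dt T Nt.
  rewrite -[leRHS]mul1r -ler_pdivrMr ?Dt_gt0 //.
  by apply: le_trans hratio _; rewrite ge_min lexx.
have hKs := hKsub Nt Ns Nt0 Ns0 dxdt.
apply: exists_fixpoint_br => //.
- by move=> k kN; apply: (@finite_Sk R r s T D LA CB Chat CI).
- by move=> k x kN; apply: (@finite_S1 R r s T D LA CB).
- by move=> k x y1; apply: (@finite_S2 R r s T D CI).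
- by move=> k x kN xS; apply: (@S1_neq0 R r s T D LA CB Chat CI cK (beta Ns) m0 K).
- by case: hb.
- by move=> k x y1; apply: (@sum_beta_S2 R r s T D CI).
- by move=> k kN; exact: tgrid_itv.
Qed.
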